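(* Let $\alpha\in(0,1)$. For every $\lambda>\frac{1}{8\pi^2\alpha}$ and every $\mu\in(0,1]$, there exists $C_\lambda>0$ such that for every nonzero function $u\in (H^2_{rad}\cap C^{\alpha})(\mathbb{R}^4)$, $$\|u\|_{L^{\infty}}^2\leq\lambda\,\|u\|_{\mu}^2\,\log\left(C_{\lambda}+\frac{8^{\alpha}\mu^{-\alpha}\|u\|_{C^{\alpha}}}{\|u\|_{\mu}}\right),$$ where $\|u\|_{\mu}^2:=(1+3\mu)\|\Delta u\|_{L^2}^2+3\mu\|u\|_{H^1}^2$.
   Context: $H^2_{rad}(\mathbb{R}^4)$ is the space of radially symmetric functions in the Sobolev space $H^2(\mathbb{R}^4)=W^{2,2}(\mathbb{R}^4)$. $C^\alpha=C^\alpha(\mathbb{R}^4)$ is the space of $\alpha$-Hölder continuous functions with norm $\|u\|_{C^\alpha}=\|u\|_{L^\infty(\mathbb{R}^4)}+\sup_{x\neq y}\frac{|u(x)-u(y)|}{|x-y|^\alpha}$. $\|u\|_{H^1}^2=\|u\|_{L^2}^2+\|\nabla u\|_{L^2}^2$. All norms are over $\mathbb{R}^4$. *)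

(* Defs.v *)
From HB Require Import structures.
From mathcomp Require Import all_boot all_order all_algebra.
From mathcomp Require Import all_classical all_reals all_analysis.
Set Implicit Arguments.
Unset Strict Implicit.
Unset Printing Implicit Defensive.
Import Order.TTheory GRing.Theory Num.Theory.
Import numFieldNormedType.Exports.
Local Open Scope classical_set_scope.
Local Open Scope ring_scope.

(* R^4 is an iterated product, so that it carries the library's product
   topology, product (Borel) sigma-algebra and product measure. The library's
   norm `|x| on it is the max norm; the Euclidean norm is [enorm] below.
   Leb4 is the same type, seen as a measurable space. *)
Notation R4 R := (R * R * R * R)%type.
Notation Leb4 R := (measurableTypeR R * measurableTypeR R *
  measurableTypeR R * measurableTypeR R)%type.

Section Sobolev4.
Variable R : realType.

Implicit Types (x y : R4 R) (u g phi : R4 R -> R).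
Implicit Types (i : 'I_4) (s : seq 'I_4) (alpha mu : R).

Definition leb4 : {measure set (Leb4 R) -> \bar R} :=
  (@lebesgue_measure R \x @lebesgue_measure R \x @lebesgue_measure R
   \x @lebesgue_measure R)%E.

Definition coords x : 4.-tuple R := [tuple x.1.1.1; x.1.1.2; x.1.2; x.2].

Definition enorm x : R := Num.sqrt (\sum_(i < 4) tnth (coords x) i ^+ 2).

Definition basis4 i : R4 R :=
  ((i == 0 :> nat)%N%:R, (i == 1 :> nat)%N%:R,
   (i == 2 :> nat)%N%:R, (i == 3 :> nat)%N%:R).

Definition partial i phi : R4 R -> R := 'D_(basis4 i) phi.

Definition partials s phi : R4 R -> R := foldr partial phi s.

Definition test_function phi : Prop :=
  (forall s, continuous (partials s phi) /\
     forall i x, derivable (partials s phi) x (basis4 i)) /\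
  compact (closure [set x | phi x != 0]).

(* Extended-real norm, +oo when u is not in L^p. *)
Definition LpNorm (p : \bar R) u : \bar R := 'N[leb4]_p[EFin \o u]%E.

Definition in_L2 u : Prop :=
  measurable_fun setT (u : Leb4 R -> R) /\ (LpNorm 2%:E u < +oo)%E.

(* g is the distributional derivative of u along the indices in s, and is in
   L^2. *)
Definition is_weakD s u g : Prop :=
  in_L2 g /\
  forall phi, test_function phi ->
    \int[leb4]_x (u x * partials s phi x) =
    (-1) ^+ size s * \int[leb4]_x (g x * phi x).

Definition H2 u : Prop :=
  in_L2 u /\ forall s, (size s <= 2)%N -> exists g, is_weakD s u g.

(* A representative of the weak derivative, which is unique up to a null set;
   meaningful only when a weak derivative in L^2 exists. *)
Definition weakD s u : R4 R -> R := xget (fun=> 0) [set g | is_weakD s u g].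

Definition grad_norm u : R4 R -> R :=
  fun x => Num.sqrt (\sum_(i < 4) weakD [:: i] u x ^+ 2).

Definition laplacian u : R4 R -> R :=
  fun x => \sum_(i < 4) weakD [:: i; i] u x.

Definition radial u : Prop := forall x y, enorm x = enorm y -> u x = u y.

Definition H2rad u : Prop := H2 u /\ radial u.

Definition holder_seminorm alpha u : \bar R :=
  ereal_sup [set (`|u z.1 - u z.2| / enorm (z.1 - z.2) `^ alpha)%:E
            | z in [set z : R4 R * R4 R | z.1 != z.2]].

Definition holder_norm alpha u : \bar R :=
  (LpNorm +oo u + holder_seminorm alpha u)%E.

Definition holder alpha u : Prop := (holder_norm alpha u < +oo)%E.

Definition H1norm_sq u : R :=
  fine (LpNorm 2%:E u) ^+ 2 + fine (LpNorm 2%:E (grad_norm u)) ^+ 2.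

Definition munorm_sq mu u : R :=
  (1 + 3 * mu) * fine (LpNorm 2%:E (laplacian u)) ^+ 2 +
  3 * mu * H1norm_sq u.

Definition munorm mu u : R := Num.sqrt (munorm_sq mu u).

End Sobolev4.

(* Main.v *)
Require Import Defs.
From HB Require Import structures.
From mathcomp Require Import all_boot all_order all_algebra.
From mathcomp Require Import all_classical all_reals all_analysis.
From mathcomp Require Import ess_sup_inf measurable_realfun ring lra.
Import Order.TTheory GRing.Theory Num.Theory.
Import numFieldNormedType.Exports.
Local Open Scope classical_set_scope.
Local Open Scope ring_scope.
Set Implicit Arguments.
Unset Strict Implicit.
Unset Printing Implicit Defensive.

(** In dimension four [1 / |x - y| ^ 2] is, up to a factor, the fundamental
    solution of the Laplacian. Write [q] for [|x - y| ^ 2]. The regularised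
    profile [1 / (q + a)] has Laplacian [- 8 a / (q + a) ^ 3], a kernel of
    total mass [- 4 pi ^ 2] concentrated at distance [sqrt a] from [y].
    Pairing the weak Laplacian of [u] with [chi (q) / (q + a)], where [chi] is
    a smooth cutoff vanishing for [q >= b], therefore gives back
    [4 pi ^ 2 * u y] up to errors, and every error is harmless:
    - the oscillation of [u] over the kernel is at most a constant times the
      Holder norm times [a ^ (alpha / 2)];
    - the derivatives of the cutoff live at scale [b] and contribute a constant
      times [|u|_2 / b].
    The pairing itself is bounded by Cauchy-Schwarz, and the square of the
    L2 norm of the test function is at most [pi ^ 2 * ln (1 + b / a)]. Hence
    [pointwise_bound]: for all [0 < a <= b] with [1 <= b],

      [|u y| <= |Lap u|_2 / (4 pi) * sqrt (ln (1 + b / a))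
                + C * (|u|_2 / b + |u|_(C^alpha) * a ^ (alpha / 2))].

    With [b = mu ^ (- 1 / 2)] both [|Lap u|_2] and [|u|_2 / b] are at most
    [|u|_mu]. The radius is chosen so that the Holder error also equals
    [|u|_mu], capped at [b]; then [ln (1 + b / a)] is at most [ln 2] plus
    [2 / alpha] times [ln (1 + Z)], where [Z] is the quotient in the statement.
    Squaring yields the coefficient [1 / (8 pi ^ 2 alpha)] in front of
    [ln (1 + Z)], up to a factor as close to 1 as desired
    ([sqrD_le_weighted]); the room left below [lambda] absorbs the bounded
    remainder into the constant inside the logarithm ([log_absorb]).

    The lemmas carrying this are: [smooth_test_function], which makes the
    truncated profile an admissible test function; [laplacian_radial] and
    [laplacian_profile_bound] for its Laplacian; [integral_leb4_radial], polar
    coordinates with the exact constant [pi ^ 2], on which sharpness rests;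
    [weak_laplacian]; and [le_Linfty], which replaces the essential supremum
    by pointwise values. *)

(** * A smooth function flat at the origin *)

Section Flat.
Context {R : realType}.
Implicit Types (x : R) (k : nat).

(** The negative powers make the family closed under derivation, see
    [is_derive_flat]. *)
Definition flat k x : R :=
  if 0 < x then x^-1 ^+ k * expR (- x^-1) else 0.

Lemma flat_gt0E k x : 0 < x -> flat k x = x^-1 ^+ k * expR (- x^-1).
Proof. by rewrite /flat => ->. Qed.

Lemma flat_le0E k x : x <= 0 -> flat k x = 0.
Proof. by rewrite /flat ltNge => ->. Qed.

Lemma flat_ge0 k x : 0 <= flat k x.
Proof.
rewrite /flat; case: ifPn => // x0.
by rewrite mulr_ge0 ?expR_ge0 ?exprn_ge0 ?invr_ge0 ?ltW.
Qed.

(** One term of the exponential series beats the power. *)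
Lemma flat_le_fact k x : flat k x <= k`!%:R.
Proof.
rewrite /flat; case: ifPn => [x0|_]; last exact: ler0n.
have y0 : 0 <= x^-1 by rewrite invr_ge0 ltW.
rewrite expRN ler_pdivrMr ?expR_gt0 // mulrC.
rewrite -ler_pdivrMr ?ltr0n ?fact_gt0 //.
case: k => [|k].
  rewrite expr0 fact0 divr1; apply: le_trans (expR_ge1Dx _).
  by rewrite lerDl.
by apply: le_trans (expR_ge1Dxn k y0); rewrite lerDr.
Qed.

(** Lowering the power by two costs a factor [x ^+ 2], which makes every
    [flat k] vanish to second order at the origin. *)
Lemma flat_le_sqr k x : flat k x <= k.+2`!%:R * x ^+ 2.
Proof.
have [x0|x0] := ltP 0 x; last by rewrite flat_le0E // mulr_ge0 ?sqr_ge0.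
have -> : flat k x = flat k.+2 x * x ^+ 2.
  rewrite !flat_gt0E // mulrAC; congr (_ * _).
  by rewrite -addn2 exprD -mulrA -exprMn mulVf ?gt_eqF // expr1n mulr1.
by rewrite ler_wpM2r ?sqr_ge0 // flat_le_fact.
Qed.

Lemma is_derive_sqr_bound (f : R -> R) (C : R) :
  (forall x, `|f x| <= C * x ^+ 2) -> is_derive (0 : R) (1 : R) f 0.
Proof.
move=> fC.
have f0 : f 0 = 0.
  by apply/eqP; rewrite -normr_le0 (le_trans (fC 0)) // expr0n mulr0.
have cv : (fun h : R => h^-1 *: ((f \o shift (0 : R)) (h *: (1 : R)) - f 0))
    @ 0^' --> (0 : R).
  apply/cvgr0Pnorm_le => e e0.
  near=> h.
  rewrite /= f0 subr0 addr0 scaler1.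
  have h0 : h != 0 by near: h; exact: nbhs_dnbhs_neq.
  rewrite normrZ normfV ler_pdivrMl ?normr_gt0 //.
  apply: (le_trans (fC h)).
  rewrite -real_normK ?num_real // expr2 mulrA mulrC.
  rewrite ler_wpM2l ?normr_ge0 //.
  have hC : `|h| <= e / (`|C| + 1).
    near: h; apply: dnbhs0_le.
    by rewrite divr_gt0 // ltr_wpDl.
  rewrite (le_trans (ler_norm _)) // normrM normr_id.
  apply: (@le_trans _ _ (`|C| * (e / (`|C| + 1)))).
    by rewrite ler_wpM2l.
  rewrite mulrCA ger_pMr // ler_pdivrMr ?ltr_wpDl // mul1r.
  by rewrite lerDl.
apply: DeriveDef; first by apply/cvg_ex; exists 0.
by apply: cvg_lim => //.
Unshelve. all: by end_near. Qed.

Lemma is_derive_flat k x :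
  is_derive x (1 : R) (flat k) (flat k.+2 x - k%:R * flat k.+1 x).
Proof.
have [x0|x0|<-] := ltgtP 0 x; last 2 first.
- rewrite !(flat_le0E _ (ltW x0)) mulr0 subr0.
  apply: (@near_eq_is_derive _ _ _ (cst 0)).
  near=> y; rewrite flat_le0E // ltW //.
  by near: y; exact: lt_nbhsl.
- rewrite !(flat_le0E _ (lexx 0)) mulr0 subr0.
  apply: (@is_derive_sqr_bound _ k.+2`!%:R) => y.
  by rewrite ger0_norm ?flat_ge0 // flat_le_sqr.
have nx0 : x != 0 by rewrite gt_eqF.
have dV : is_derive x (1 : R) (fun y : R => y^-1) (- x ^- 2).
  apply: is_derive_eq; first exact: (@is_deriveV _ id).
  by rewrite scaler1.
have dE : is_derive x (1 : R) (fun y : R => expR (- y^-1))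
    (expR (- x^-1) * x ^- 2).
  have dN : is_derive x (1 : R) (fun y : R => - y^-1) (x ^- 2).
    by apply: is_derive_eq (is_deriveN dV) _; rewrite opprK.
  exact: (is_derive1_comp (is_derive_expR _) dN).
have dP : is_derive x (1 : R) (fun y : R => y^-1 ^+ k)
    (- (k%:R * x^-1 ^+ k.+1)).
  case: k => [|k].
    rewrite mul0r oppr0; under eq_fun do rewrite expr0; exact: is_derive_cst.
  have := @is_deriveX _ _ _ k.+1 _ _ _ dV; rewrite exprfctE => dX.
  apply: is_derive_eq dX _.
  by rewrite /GRing.scale /= -exprVn !exprS; ring.
have dF : is_derive x (1 : R) (fun y : R => y^-1 ^+ k * expR (- y^-1))
    (flat k.+2 x - k%:R * flat k.+1 x).
  apply: is_derive_eq (is_deriveM dP dE) _.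
  by rewrite !flat_gt0E // /GRing.scale /= -exprVn !exprS; ring.
apply: near_eq_is_derive dF; near=> y; rewrite flat_gt0E //.
by near: y; exact: lt_nbhsr.
Unshelve. all: by end_near. Qed.

End Flat.

(** * Smooth fields and the radial Laplacian in dimension four *)

Section Smooth.
Context {R : realType}.
Implicit Types (f g : R4 R -> R) (x y v : R4 R) (i : 'I_4).

(** Restricting to a line turns directional derivatives into ordinary ones, so
    that the one-variable chain rule becomes available. *)
Lemma is_derive_lineP f x v d :
  is_derive x v f d <-> is_derive (0 : R) (1 : R) (fun h => f (h *: v + x)) d.
Proof.
have E : (fun h : R => h^-1 *: ((f \o shift x) (h *: v) - f x)) =
  (fun h : R => h^-1 *: (((fun h => f (h *: v + x)) \o shift (0 : R))
    (h *: (1 : R)) - (fun h => f (h *: v + x)) 0)).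
  by apply/funext => h /=; rewrite addr0 scale0r add0r scaler1.
split=> -[dv de]; apply: DeriveDef.
- by move: dv; rewrite /derivable E.
- by move: de; rewrite /derive E.
- by rewrite /derivable E.
- by rewrite /derive E.
Qed.

Lemma is_derive_comp_dir (F : R -> R) f x v a b :
  is_derive (f x) (1 : R) F a -> is_derive x v f b ->
  is_derive x v (F \o f) (a * b).
Proof.
move=> dF /is_derive_lineP df; apply/is_derive_lineP.
apply: (is_derive1_comp _ df).
by rewrite /= scale0r add0r.
Qed.

Definition coord i x : R := tnth (coords x) i.

Lemma ord4P (P : 'I_4 -> Prop) :
  P 0 -> P 1 -> P 2 -> P 3 -> forall i, P i.
Proof.
move=> P0 P1 P2 P3 [[|[|[|[|//]]]] lti].
- by rewrite (_ : Ordinal lti = 0) //; exact: val_inj.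
- by rewrite (_ : Ordinal lti = 1) //; exact: val_inj.
- by rewrite (_ : Ordinal lti = 2) //; exact: val_inj.
- by rewrite (_ : Ordinal lti = 3) //; exact: val_inj.
Qed.

Lemma coord_lin i (h : R) v x : coord i (h *: v + x) = h * coord i v + coord i x.
Proof. by elim/ord4P: i. Qed.

Lemma coord_basis i j : coord j (basis4 R i) = (i == j)%:R.
Proof. by elim/ord4P: j; elim/ord4P: i. Qed.

Lemma is_derive_coord i x v : is_derive x v (coord i) (coord i v).
Proof.
apply/is_derive_lineP; under eq_fun do rewrite coord_lin.
have d1 : is_derive (0 : R) (1 : R) (fun h : R => h * coord i v) (coord i v).
  apply: is_derive_eq (is_deriveM (is_derive_id _ _) (is_derive_cst _ _ _)) _.
  by rewrite scaler0 add0r scaler1.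
by apply: is_derive_eq (is_deriveD d1 (is_derive_cst _ _ _)) _; rewrite addr0.
Qed.

Lemma continuous_fst1 : continuous (fun x => x.1.1).
Proof.
by move=> x; apply: (@continuous_comp _ _ _ fst fst); exact: cvg_fst.
Qed.

Lemma continuous_coord i : continuous (coord i).
Proof.
elim/ord4P: i => x; rewrite /coord /coords /=.
- by apply: (@continuous_comp _ _ _ (fun z : R4 R => z.1.1) fst);
   [exact: continuous_fst1|exact: cvg_fst].
- by apply: (@continuous_comp _ _ _ (fun z : R4 R => z.1.1) snd);
   [exact: continuous_fst1|exact: cvg_snd].
- by apply: (@continuous_comp _ _ _ (fun z : R4 R => z.1) snd);
   [exact: cvg_fst|exact: cvg_snd].
- exact: cvg_snd.
Qed.

Lemma measurable_coord i : measurable_fun setT (coord i : Leb4 R -> R).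
Proof.
elim/ord4P: i; rewrite /coord /coords /=.
- apply: (@measurableT_comp _ _ _ _ _ _ fst _
    (fun z : Leb4 R => z.1.1)) => //.
  exact: (@measurableT_comp _ _ _ _ _ _ fst _ fst).
- apply: (@measurableT_comp _ _ _ _ _ _ snd _
    (fun z : Leb4 R => z.1.1)) => //.
  exact: (@measurableT_comp _ _ _ _ _ _ fst _ fst).
- exact: (@measurableT_comp _ _ _ _ _ _ snd _ fst).
- exact: measurable_snd.
Qed.

Lemma continuous_flat k : continuous (@flat R k).
Proof.
move=> x; apply/differentiable_continuous/derivable1_diffP.
by case: (is_derive_flat k x).
Qed.

(** A class of fields closed under all partial derivatives; membership
    therefore yields infinite differentiability at once. *)
Inductive smooth : (R4 R -> R) -> Prop :=
| smooth_cst c : smooth (cst c)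
| smooth_coord i : smooth (coord i)
| smoothD f g : smooth f -> smooth g -> smooth (fun x => f x + g x)
| smoothM f g : smooth f -> smooth g -> smooth (fun x => f x * g x)
| smooth_flat k f : smooth f -> smooth (flat k \o f)
| smoothV f : smooth f -> (forall x, 0 < f x) -> smooth (fun x => (f x)^-1).

Lemma smooth_is_derive f : smooth f -> forall i, exists2 df, smooth df &
  forall x, is_derive x (basis4 R i) f (df x).
Proof.
move=> sf i; elim: sf => {f} [c|j|f g sf [df sdf Hf] sg [dg sdg Hg]
  |f g sf [df sdf Hf] sg [dg sdg Hg]|k f sf [df sdf Hf]
  |f sf [df sdf Hf] f0].
- by exists (cst 0) => [|x]; [exact: smooth_cst|exact: is_derive_cst].
- exists (cst ((i == j)%:R)) => [|x]; first exact: smooth_cst.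
  by rewrite /= -coord_basis; exact: is_derive_coord.
- exists (fun x => df x + dg x) => [|x]; first exact: smoothD.
  exact: is_deriveD (Hf x) (Hg x).
- exists (fun x => f x * dg x + g x * df x) => [|x].
    by apply: smoothD; exact: smoothM.
  exact: is_deriveM (Hf x) (Hg x).
- exists (fun x => (flat k.+2 (f x) + - k%:R * flat k.+1 (f x)) * df x) => [|x].
    apply: smoothM => //; apply: smoothD.
      exact: (smooth_flat k.+2 sf).
    by apply: smoothM; [exact: smooth_cst|exact: (smooth_flat k.+1 sf)].
  apply: is_derive_comp_dir (Hf x); rewrite mulNr; exact: is_derive_flat.
- exists (fun x => - 1 * ((f x)^-1 * (f x)^-1) * df x) => [|x].
    apply: smoothM => //; apply: smoothM; first exact: smooth_cst.
    by apply: smoothM; exact: smoothV.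
  apply: (is_derive_comp_dir (F := fun z : R => z^-1)) (Hf x).
  have fx0 : f x != 0 by rewrite gt_eqF.
  have := @is_deriveV _ id (f x) 1 1 fx0 (is_derive_id _ _) => dV.
  by apply: is_derive_eq dV _; rewrite scaler1 mulN1r -expr2 exprVn.
Qed.

Lemma smooth_continuous f : smooth f -> continuous f.
Proof.
elim=> {f} [c|j|f g _ cf _ cg|f g _ cf _ cg|k f _ cf|f _ cf f0] x.
- exact: cst_continuous.
- exact: continuous_coord.
- exact: continuousD (cf x) (cg x).
- exact: continuousM (cf x) (cg x).
- exact: continuous_comp (cf x) (@continuous_flat k _).
- by apply: continuousV (cf x); rewrite gt_eqF.
Qed.

Lemma smooth_measurable f : smooth f -> measurable_fun setT (f : Leb4 R -> R).
Proof.
elim=> {f} [c|j|f g _ cf _ cg|f g _ cf _ cg|k f _ cf|f _ cf f0].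
- exact: measurable_cst.
- exact: measurable_coord.
- exact: measurable_funD.
- exact: measurable_funM.
- apply: measurableT_comp cf.
  by apply: continuous_measurable_fun; exact: continuous_flat.
- rewrite (_ : (fun x => _) = (fun x => (f x) `^ (-1))); last first.
    by apply/funext => x; rewrite powR_inv1 // ltW.
  exact: (measurableT_comp (measurable_powR (-1))).
Qed.

Lemma smooth_partial i f : smooth f -> smooth (partial i f).
Proof.
move=> /smooth_is_derive /(_ i) [df sdf Hf].
suff -> : partial i f = df by [].
by apply/funext => x; case: (Hf x).
Qed.

Lemma smooth_partials s f : smooth f -> smooth (partials s f).
Proof. by move=> sf; elim: s => //= i s; exact: smooth_partial. Qed.

Lemma smooth_test_function f :
  smooth f -> compact (closure [set x | f x != 0]) -> test_function f.
Proof.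
move=> sf cf; split=> // s; have ss := smooth_partials s sf.
split=> [|i x]; first exact: smooth_continuous.
by have [df _ /(_ x)[]] := smooth_is_derive ss i.
Qed.

Lemma smoothB f g : smooth f -> smooth g -> smooth (fun x => f x - g x).
Proof.
move=> sf sg; rewrite (_ : (fun x => _) = (fun x => f x + cst (-1) x * g x)).
  by apply: smoothD => //; apply: smoothM => //; exact: smooth_cst.
by apply/funext => x /=; rewrite mulN1r.
Qed.

Definition sqdist y x : R := \sum_(i < 4) (coord i x - coord i y) ^+ 2.

Lemma big_ord4 (F : 'I_4 -> R) : \sum_(i < 4) F i = F 0 + F 1 + F 2 + F 3.
Proof.
rewrite !big_ord_recl big_ord0 addr0 !addrA.
by do ?[congr (_ + _)]; congr F; exact: val_inj.
Qed.

Lemma sqdistE y x : sqdist y x =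
  (x.1.1.1 - y.1.1.1) ^+ 2 + (x.1.1.2 - y.1.1.2) ^+ 2 +
  (x.1.2 - y.1.2) ^+ 2 + (x.2 - y.2) ^+ 2.
Proof. by rewrite /sqdist big_ord4. Qed.

Lemma sqdist_ge0 y x : 0 <= sqdist y x.
Proof. by apply: sumr_ge0 => i _; exact: sqr_ge0. Qed.

Lemma smooth_sqdist y : smooth (sqdist y).
Proof.
have s i : smooth (fun x => (coord i x - coord i y) ^+ 2).
  have sc : smooth (fun x => coord i x - cst (coord i y) x).
    by apply: smoothB; [exact: smooth_coord|exact: smooth_cst].
  exact: (smoothM sc sc).
rewrite (_ : sqdist y = fun x => (coord 0 x - coord 0 y) ^+ 2 +
  (coord 1 x - coord 1 y) ^+ 2 + (coord 2 x - coord 2 y) ^+ 2 +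
  (coord 3 x - coord 3 y) ^+ 2); last first.
  by apply/funext => x; rewrite /sqdist big_ord4.
by do 3![apply: smoothD => //].
Qed.

(** The ball sits in a product of four segments. *)
Lemma compact_sqdist_le y b : compact (closure [set x | sqdist y x < b]).
Proof.
pose r := Num.sqrt `|b|.
pose I c := `[c - r, c + r]%classic : set R.
pose K : set (R4 R) := I y.1.1.1 `*` I y.1.1.2 `*` I y.1.2 `*` I y.2.
have cK : compact K by do 3![apply: compact_setX; last exact: segment_compact];
  exact: segment_compact.
apply: (@subclosed_compact _ _ K) => //; first exact: closed_closure.
have clK : closed K by apply: compact_closed => //; exact: norm_hausdorff.
rewrite ((closure_id K).1 clK); apply: closure_subset => x /=.
rewrite sqdistE => qb.
have H (z : R) : z ^+ 2 < b -> `|z| <= r.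
  move=> zb; rewrite -sqrtr_sqr ler_wsqrtr // (le_trans (ltW zb)) //.
  exact: ler_norm.
have bnd (c z : R) : (z - c) ^+ 2 < b -> I c z.
  by move=> /H; rewrite ler_distl /I /= in_itv /=.
have [? ? ? ?] : [/\ 0 <= (x.1.1.1 - y.1.1.1) ^+ 2,
  0 <= (x.1.1.2 - y.1.1.2) ^+ 2, 0 <= (x.1.2 - y.1.2) ^+ 2 &
  0 <= (x.2 - y.2) ^+ 2] by split; exact: sqr_ge0.
by split; [split; [split|]|]; apply: bnd; lra.
Qed.

Lemma partial2_radial y (F F1 F2 : R -> R) :
  (forall t : R, 0 <= t -> is_derive t (1 : R) F (F1 t)) ->
  (forall t : R, 0 <= t -> is_derive t (1 : R) F1 (F2 t)) ->
  forall i x, partials [:: i; i] (F \o sqdist y) x =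
    4 * (coord i x - coord i y) ^+ 2 * F2 (sqdist y x) + 2 * F1 (sqdist y x).
Proof.
move=> dF dF1 i x.
have dq z : is_derive z (basis4 R i) (sqdist y) (2 * (coord i z - coord i y)).
  have dj j : is_derive z (basis4 R i) (fun w => (coord j w - coord j y) ^+ 2)
      (2 * (coord j z - coord j y) * (i == j)%:R).
    have := is_deriveB (is_derive_coord j z (basis4 R i))
      (is_derive_cst (coord j y) z (basis4 R i)).
    move=> dB; apply: is_derive_eq (is_deriveM dB dB) _.
    rewrite coord_basis /GRing.scale /= subr0.
    by rewrite [(_ - cst _) z](_ : _ = coord j z - coord j y) //; ring.
  have := is_derive_sum dj; rewrite fct_sumE => ds.
  apply: is_derive_eq ds _; rewrite (bigD1 i) //= eqxx mulr1 big1 ?addr0 //.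
  by move=> j; rewrite eq_sym => /negbTE ->; rewrite mulr0.
have p1 : partial i (F \o sqdist y) =
    (fun z => F1 (sqdist y z) * (2 * (coord i z - coord i y))).
  apply/funext => z.
  by case: (is_derive_comp_dir (dF _ (sqdist_ge0 y z)) (dq z)).
rewrite /= p1.
have d1 := is_derive_comp_dir (dF1 _ (sqdist_ge0 y x)) (dq x).
have d2 : is_derive x (basis4 R i) (fun z => 2 * (coord i z - coord i y)) 2.
  have := is_deriveB (is_derive_coord i x (basis4 R i))
    (is_derive_cst (coord i y) _ _).
  move=> dB; have dd := is_deriveZ (2 : R) dB; apply: is_derive_eq dd _.
  by rewrite coord_basis eqxx subr0 scaler1.
rewrite /partial; case: (is_deriveM d1 d2) => _ ->.
by rewrite /GRing.scale /=; ring.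
Qed.

(** The factor 8 is twice the dimension; the profile is a function of the
    squared distance, which keeps it smooth at the centre. *)
Lemma laplacian_radial y (F F1 F2 : R -> R) :
  (forall t : R, 0 <= t -> is_derive t (1 : R) F (F1 t)) ->
  (forall t : R, 0 <= t -> is_derive t (1 : R) F1 (F2 t)) ->
  forall x, \sum_(i < 4) partials [:: i; i] (F \o sqdist y) x =
    4 * sqdist y x * F2 (sqdist y x) + 8 * F1 (sqdist y x).
Proof.
move=> dF dF1 x; under eq_bigr do rewrite (partial2_radial y dF dF1).
rewrite big_split /= -!mulr_suml -mulr_sumr -/(sqdist y x) sumr_const card_ord.
by rewrite -mulr_natl; ring.
Qed.

End Smooth.

(** * The truncated fundamental profile *)

Section Profile.
Context {R : realType}.
Variables (a b : R).
Hypotheses (a0 : 0 < a) (b0 : 0 < b).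
Implicit Types (t : R).

Let T t : R := 1 - (t / b) ^+ 2.

(** Squaring [t / b] makes the first derivative of the cutoff of size
    [t / b ^ 2], which offsets the factor [(t + a) ^-1] in the Laplacian of the
    profile near the centre. *)
Definition cutoff t : R := expR 1 * flat 0 (1 - (t / b) ^+ 2).

Definition cutoff1 t : R := expR 1 * flat 2 (T t) * - (2 * t / b ^+ 2).

Definition cutoff2 t : R :=
  expR 1 * (flat 4 (T t) - 2 * flat 3 (T t)) * (2 * t / b ^+ 2) ^+ 2
  - expR 1 * flat 2 (T t) * (2 / b ^+ 2).

(** The truncation of [(t + a) ^-1], a regularised fundamental solution of the
    four-dimensional Laplacian in the variable [t = |x - y| ^ 2]. *)
Definition profile t : R := cutoff t * (t + a)^-1.

Definition profile1 t : R :=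
  cutoff1 t * (t + a)^-1 - cutoff t * (t + a)^-1 ^+ 2.

Definition profile2 t : R :=
  cutoff2 t * (t + a)^-1 - 2 * cutoff1 t * (t + a)^-1 ^+ 2
  + 2 * cutoff t * (t + a)^-1 ^+ 3.

Let is_derive_T t : is_derive t (1 : R) T (- (2 * t / b ^+ 2)).
Proof.
have d1 : is_derive t (1 : R) (fun s : R => s / b) b^-1.
  apply: is_derive_eq (is_deriveM (is_derive_id _ _) (is_derive_cst _ _ _)) _.
  by rewrite scaler0 add0r scaler1.
have d2 := is_deriveB (is_derive_cst (1 : R) t (1 : R)) (is_deriveM d1 d1).
apply: is_derive_eq d2 _.
by rewrite /GRing.scale /= sub0r; field; rewrite gt_eqF.
Qed.

Let is_derive_flatT k t : is_derive t (1 : R) (fun s => flat k (T s))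
  ((flat k.+2 (T t) - k%:R * flat k.+1 (T t)) * - (2 * t / b ^+ 2)).
Proof. exact: is_derive1_comp (is_derive_flat k (T t)) (is_derive_T t). Qed.

Let is_derive_cutoff t : is_derive t (1 : R) cutoff (cutoff1 t).
Proof.
apply: is_derive_eq (is_deriveZ (expR 1) (is_derive_flatT 0 t)) _.
by rewrite /cutoff1 mul0r subr0 /GRing.scale /= mulrA.
Qed.

Let is_derive_cutoff1 t : is_derive t (1 : R) cutoff1 (cutoff2 t).
Proof.
have dl : is_derive t (1 : R) (fun s : R => - (2 * s / b ^+ 2)) (- (2 / b ^+ 2)).
  have := is_deriveZ (- (2 / b ^+ 2)) (is_derive_id t (1 : R)) => dZ.
  rewrite (_ : (fun s => _) = (- (2 / b ^+ 2)) *: id); last first.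
    by apply/funext => s; rewrite [RHS](_ : _ = - (2 / b ^+ 2) * s) //; ring.
  by apply: is_derive_eq dZ _; rewrite scaler1.
have dF := is_deriveZ (expR 1) (is_derive_flatT 2 t).
apply: is_derive_eq (is_deriveM dF dl) _.
rewrite [X in X *: _](_ : _ = expR 1 * flat 2 (T t)) //.
by rewrite /cutoff2 /GRing.scale /=; ring.
Qed.

Let is_derive_shiftV t : 0 <= t ->
  is_derive t (1 : R) (fun s : R => (s + a)^-1) (- (t + a)^-1 ^+ 2).
Proof.
move=> t0; have ta : t + a != 0 by rewrite gt_eqF // ltr_wpDl.
have dl := is_deriveD (is_derive_id t (1 : R)) (is_derive_cst a _ _).
have dV := is_deriveV (f := fun s : R => s + a) ta dl.
apply: is_derive_eq dV _.
by rewrite /GRing.scale /= addr0 mulr1 exprVn.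
Qed.

Lemma is_derive_profile t : 0 <= t ->
  is_derive t (1 : R) profile (profile1 t).
Proof.
move=> t0.
apply: is_derive_eq (is_deriveM (is_derive_cutoff t) (is_derive_shiftV t0)) _.
by rewrite /profile1 /GRing.scale /=; ring.
Qed.

Lemma is_derive_profile1 t : 0 <= t ->
  is_derive t (1 : R) profile1 (profile2 t).
Proof.
move=> t0; have dV := is_derive_shiftV t0.
have d1 := is_deriveM (is_derive_cutoff1 t) dV.
have d2 := is_deriveM (is_derive_cutoff t) (is_deriveM dV dV).
apply: is_derive_eq (is_deriveB d1 d2) _.
by rewrite !fctE /profile2 /GRing.scale /=; ring.
Qed.

Lemma cutoff_ge0 t : 0 <= cutoff t.
Proof. by rewrite mulr_ge0 ?expR_ge0 ?flat_ge0. Qed.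

Let T_le0 t : b <= t -> T t <= 0.
Proof.
move=> bt; rewrite subr_le0 -[leLHS](expr1n _ 2) lerXn2r ?nnegrE //.
  by rewrite divr_ge0 ?ltW // (lt_le_trans b0).
by rewrite ler_pdivlMr // mul1r.
Qed.

Lemma cutoff_eq0 t : b <= t -> cutoff t = 0.
Proof. by move=> bt; rewrite /cutoff flat_le0E ?mulr0 //; exact: T_le0. Qed.

Lemma profile_eq0 t : b <= t -> profile t = 0.
Proof. by move=> bt; rewrite /profile cutoff_eq0 // mul0r. Qed.

Lemma profile1_eq0 t : b <= t -> profile1 t = 0.
Proof.
move=> bt; rewrite /profile1 /cutoff1 cutoff_eq0 // (flat_le0E _ (T_le0 bt)).
by rewrite mulr0 !mul0r subr0.
Qed.

Lemma profile2_eq0 t : b <= t -> profile2 t = 0.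
Proof.
move=> bt; rewrite /profile2 /cutoff2 /cutoff1 cutoff_eq0 //.
by rewrite !(flat_le0E _ (T_le0 bt)) !(mulr0, mul0r, subr0, addr0).
Qed.

Lemma cutoff_le1 t : cutoff t <= 1.
Proof.
rewrite /cutoff /flat; case: ifPn => [T0|_]; last by rewrite mulr0.
rewrite expr0 mul1r -expRD -[leRHS]expR0 ler_expR subr_le0.
rewrite invr_ge1 ?unitfE ?gt_eqF // ?lerBlDr ?lerDl ?sqr_ge0 //.
Qed.

(** The tangent-line bound for the exponential while [(t / b) ^ 2 < 1 / 2];
    from that point on the right-hand side is at least 1. *)
Lemma cutoff_ge t : 1 - cutoff t <= 2 * (t / b) ^+ 2.
Proof.
have := cutoff_ge0 t; rewrite /cutoff; set s := (t / b) ^+ 2.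
have s0 : 0 <= s by exact: sqr_ge0.
have [s2|s2] := lerP (2^-1) s; first by move=> ?; lra.
move=> _; have T0 : 0 < 1 - s by lra.
rewrite flat_gt0E // expr0 mul1r -expRD.
have := expR_ge1Dx (1 - (1 - s)^-1).
suff : (1 - s)^-1 <= 1 + 2 * s by lra.
by rewrite invf_ple ?posrE -?[leLHS]div1r ?ler_pdivrMr //; nra.
Qed.

Definition cutoff_cst : R := 656 * expR 1.

Lemma cutoff_cst_ge0 : 0 <= cutoff_cst.
Proof. by apply: mulr_ge0; [exact: ler0n|exact: expR_ge0]. Qed.

(** Away from the singular part [- 8 a / (t + a) ^ 3], the radial Laplacian of
    the profile only sees derivatives of the cutoff. *)
Lemma laplacian_profile_bound t : 0 <= t ->
  `|4 * t * profile2 t + 8 * profile1 t + 8 * a * cutoff t * (t + a)^-1 ^+ 3|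
  <= if t < b then cutoff_cst / b ^+ 2 else 0.
Proof.
rewrite /cutoff_cst.
move=> t0.
have ta : 0 < t + a by rewrite ltr_wpDl.
set e := (t + a)^-1.
have e0 : 0 < e by rewrite invr_gt0.
have te : t * e <= 1 by rewrite ler_pdivrMr // mul1r lerDl ltW.
have -> : 4 * t * profile2 t + 8 * profile1 t + 8 * a * cutoff t * e ^+ 3 =
    4 * (t * e) * cutoff2 t - 8 * (t * e) * (cutoff1 t * e)
    + 8 * (cutoff1 t * e).
  by rewrite /profile2 /profile1 -/e /e; field; rewrite gt_eqF.
case: ifPn => [tb|]; last first.
  rewrite -leNgt => /T_le0 Tt.
  rewrite /cutoff2 /cutoff1 !(flat_le0E _ Tt).
  by rewrite !(mul0r, mulr0, subr0, addr0) normr0.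
(* The numbers 2, 6 and 24 are the factorials bounding [flat 2], [flat 3] and
   [flat 4]; collecting them below produces 656. *)
set E := expR 1; have E0 : 0 < E by exact: expR_gt0.
set B := (b ^+ 2)^-1; have B0 : 0 < B by rewrite invr_gt0 exprn_gt0.
have f2 : flat 2 (T t) <= 2 by exact: (flat_le_fact 2).
have f3 : flat 3 (T t) <= 6 by exact: (flat_le_fact 3).
have f4 : flat 4 (T t) <= 24 by exact: (flat_le_fact 4).
have g2 := flat_ge0 2 (T t); have g3 := flat_ge0 3 (T t).
have g4 := flat_ge0 4 (T t).
have c1 : `|cutoff1 t * e| <= 4 * E * B.
  rewrite /cutoff1 -/E -/B mulrN mulNr normrN ger0_norm; last first.
    by rewrite !mulr_ge0 // ltW.
  rewrite (_ : _ * e = E * B * 2 * (flat 2 (T t) * (t * e))); last by ring.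
  rewrite (_ : 4 * E * B = E * B * 2 * (2 * 1)); last by ring.
  apply: ler_wpM2l; first by rewrite !mulr_ge0 // ltW.
  by apply: ler_pM => //; rewrite mulr_ge0 // ltW.
have tb1 : t * t * B <= 1.
  rewrite -expr2 ler_pdivrMr ?exprn_gt0 // mul1r.
  by rewrite lerXn2r ?nnegrE // ltW.
have tB0 : 0 <= t * t * B by rewrite !mulr_ge0 // ltW.
have c2 : `|cutoff2 t| <= 148 * E * B.
  rewrite /cutoff2 -/E -/B (_ : _ - _ = E * B *
    ((flat 4 (T t) - 2 * flat 3 (T t)) * (4 * (t * t * B))
     - 2 * flat 2 (T t))); last by rewrite /B; field; rewrite gt_eqF.
  rewrite normrM (ger0_norm (mulr_ge0 (ltW E0) (ltW B0))).
  rewrite -[leRHS]mulrA [leRHS]mulrC; apply: ler_wpM2l.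
    by rewrite mulr_ge0 // ltW.
  rewrite ler_norml; apply/andP; split; nra.
have te0 : 0 <= t * e by rewrite mulr_ge0 // ltW.
rewrite (le_trans (ler_normD _ _)) //.
rewrite (le_trans (lerD (ler_normB _ _) (lexx _))) //.
have n4 z : `|4 * (t * e) * z| = 4 * (t * e) * `|z|.
  by rewrite normrM ger0_norm // mulr_ge0.
have n8 z : `|8 * (t * e) * z| = 8 * (t * e) * `|z|.
  by rewrite normrM ger0_norm // mulr_ge0.
rewrite n4 n8 [X in _ + X <= _]normrM (ger0_norm (ler0n _ 8)).
rewrite -[leRHS]/(656 * E * B).
have h1 : 4 * (t * e) * `|cutoff2 t| <= 4 * (148 * E * B).
  by apply: ler_pM => //; [rewrite mulr_ge0|rewrite ger_pMr].
have h2 : 8 * (t * e) * `|cutoff1 t * e| <= 8 * (4 * E * B).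
  by apply: ler_pM => //; [rewrite mulr_ge0|rewrite ger_pMr].
by lra.
Qed.

End Profile.

(** * The area of a disc *)

Section DiscArea.
Context {R : realType}.
Notation mu := (@lebesgue_measure R).

Lemma continuous_scale (c : R) (f : R -> R) :
  continuous f -> continuous (fun x => c * f x).
Proof.
by move=> cf x; apply: (@continuousM R R (cst c) f) (cf x);
  exact: cst_continuous.
Qed.

(** Substituting [x = z0 + r sin t] turns the integrand into the square of a
    cosine. *)
Lemma integral_semicircle (r z0 : R) : 0 < r ->
  (\int[mu]_(x in `[(z0 - r)%R, (z0 + r)%R])
     (2 * Num.sqrt (r ^+ 2 - (x - z0) ^+ 2))%R%:E
   = (pi * r ^+ 2)%R%:E)%E.
Proof.
move=> r0.
pose F (t : R) : R := z0 + r * sin t.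
have dF (t : R) : is_derive t (1 : R) F (r * cos t).
  have := is_deriveD (is_derive_cst z0 t (1 : R)) (is_deriveZ r (is_derive_sin t)).
  by rewrite add0r.
have F'E : derive1 F = (fun t => r * cos t).
  by apply/funext => t; rewrite derive1E; case: (dF t).
have cF' : continuous (fun t : R => r * cos t).
  by apply: continuous_scale => t; exact: continuous_cos.
have cF : continuous F.
  move=> t; apply/differentiable_continuous/derivable1_diffP.
  by case: (dF t).
have cG : continuous
    (fun x : R => 2 * Num.sqrt (r ^+ 2 - (x - z0) ^+ 2)).
  apply: continuous_scale => x.
  apply: (@continuous_comp _ _ _ (fun x : R => r ^+ 2 - (x - z0) ^+ 2)
    (@Num.sqrt R));
    last exact: sqrt_continuous.
  have cx : {for x, continuous (fun y : R => y - z0)}.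
    by apply: (@continuousB R R R); [exact: cvg_id|exact: cst_continuous].
  by apply: (@continuousB R R R); [exact: cst_continuous|exact: (@continuousM R R)].
have pi2 : - (pi / 2) < pi / 2 :> R.
  by rewrite -subr_gt0 opprK -splitr pi_gt0.
have Fa : F (- (pi / 2)) = z0 - r by rewrite /F sinN sin_pihalf mulrN1.
have Fb : F (pi / 2) = z0 + r by rewrite /F sin_pihalf mulr1.
rewrite -Fa -Fb.
rewrite (@integration_by_substitution_increasing _ F
  (fun x => 2 * Num.sqrt (r ^+ 2 - (x - z0) ^+ 2)) _ _ (ltW pi2)); first last.
- exact: continuous_subspaceT.
- split; first by move=> x _; case: (dF x).
  + exact/cvg_at_right_filter/cF.
  + exact/cvg_at_left_filter/cF.
- rewrite F'E; apply/cvg_ex; exists (r * cos (pi / 2)).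
  exact/cvg_at_left_filter/cF'.
- rewrite F'E; apply/cvg_ex; exists (r * cos (- (pi / 2))).
  exact/cvg_at_right_filter/cF'.
- by rewrite F'E => x _; exact: cF'.
- move=> x y xI yI xy; rewrite ltrD2l ltr_pM2l //.
  by rewrite ltr_sin.
(* [P] is the antiderivative of [2 r ^ 2 cos ^ 2]. *)
pose P (t : R) : R := r ^+ 2 * (t + sin t * cos t).
have dP (t : R) : is_derive t (1 : R) P (r ^+ 2 * (2 * cos t ^+ 2)).
  have d := is_deriveZ (r ^+ 2) (is_deriveD (is_derive_id t (1 : R))
    (is_deriveM (is_derive_sin t) (is_derive_cos t))).
  apply: is_derive_eq d _; rewrite /GRing.scale /=.
  rewrite -[in RHS](mulrC (cos t ^+ 2)) mulr_natr mulr2n {2}cos2sin2; ring.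
transitivity (\int[mu]_(x in `[(- (pi / 2))%R, (pi / 2)%R])
    (r ^+ 2 * (2 * cos x ^+ 2))%R%:E)%E.
  apply: eq_integral => x; rewrite inE /= in_itv /= => xI.
  rewrite F'E /= /F fctE /= addrAC subrr add0r exprMn.
  rewrite -[X in X - _]mulr1 -mulrBr -cos2sin2 -exprMn sqrtr_sqr ger0_norm.
    by congr EFin; ring.
  by rewrite mulr_ge0 ?(ltW r0) ?cos_ge0_pihalf.
have cp : continuous (fun x : R => r ^+ 2 * (2 * cos x ^+ 2)).
  do 2 apply: continuous_scale; move=> x.
  by apply: (@continuousM R R); exact: continuous_cos.
rewrite (@continuous_FTC2 _ (fun x : R => r ^+ 2 * (2 * cos x ^+ 2)) P) //.
- rewrite -EFinB /P cosN cos_pihalf !mulr0 !addr0; by congr EFin; field.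
- exact: continuous_subspaceT.
- have cP : continuous P.
    move=> t; apply/differentiable_continuous/derivable1_diffP.
    by case: (dP t).
  split; first by move=> x _; case: (dP x).
  + exact/cvg_at_right_filter/cP.
  + exact/cvg_at_left_filter/cP.
- by move=> x _; rewrite derive1E; case: (dP x).
Qed.
End DiscArea.

(** * Polar coordinates in the plane *)

Section Radial2.
Context {R : realType}.
Notation mu := (@lebesgue_measure R).
Notation T1 := (measurableTypeR R).

(** For [s <= 0] both sides vanish, the square root of a negative number being
    0; no case distinction is then needed when integrating sections. *)
Lemma lebesgue_measure_ball_sqr (w0 s : R) :
  mu [set w | (w - w0) ^+ 2 < s] = (2 * Num.sqrt s)%:E.
Proof.
have [s0|s0] := ltP 0 s; last first.
  rewrite ler0_sqrtr // mulr0 (_ : [set _ | _] = set0) ?measure0 //.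
  rewrite -subset0 => w /= /(le_lt_trans (sqr_ge0 _)).
  by rewrite ltNge s0.
have r0 : 0 < Num.sqrt s by rewrite sqrtr_gt0.
rewrite (_ : [set _ | _] = `](w0 - Num.sqrt s), (w0 + Num.sqrt s)[%classic).
  rewrite lebesgue_measure_itv /= lte_fin ltrD2l gtrN // -EFinB.
  by congr EFin; ring.
apply/seteqP; split=> w /=; rewrite in_itv /= -ltr_distl.
  by rewrite -sqrtr_sqr ltr_sqrt.
by rewrite -[in X in X -> _]sqrtr_sqr ltr_sqrt.
Qed.

Lemma integral_sqrt_shift (s z0 : R) :
  (\int[mu]_z (2 * Num.sqrt (s - (z - z0) ^+ 2))%R%:E = (pi * Num.max s 0)%R%:E)%E.
Proof.
have [s0|s0] := ltP 0 s; last first.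
  rewrite mulr0 integral0_eq // => z _.
  rewrite ler0_sqrtr ?mulr0 // subr_le0 (le_trans s0) //; exact: sqr_ge0.
rewrite -[s in RHS](sqr_sqrtr (ltW s0)).
have r0 : 0 < Num.sqrt s by rewrite sqrtr_gt0.
rewrite -(integral_semicircle z0 r0) [RHS]integral_mkcond.
apply: eq_integral => z _; rewrite patchE sqr_sqrtr ?ltW //.
case: ifPn => //; rewrite notin_setE /= in_itv /= -ler_distl => /negP.
rewrite -ltNge => h; rewrite ler0_sqrtr ?mulr0 // subr_le0.
rewrite -(sqr_sqrtr (ltW s0)) -[leRHS]real_normK ?num_real //.
by rewrite lerXn2r ?nnegrE ?sqrtr_ge0 // ltW.
Qed.

(** The offset [c] stands for the squared distance in the two coordinates that
    are held fixed, so that the plane formula can be applied twice. *)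
Definition quad2 (c z0 w0 : R) (p : T1 * T1) : T1 :=
  c + (p.1 - z0) ^+ 2 + (p.2 - w0) ^+ 2.

Lemma measurable_quad2 c z0 w0 : measurable_fun setT (quad2 c z0 w0).
Proof.
apply: measurable_funD.
  apply: measurable_funD; first exact: measurable_cst.
  by apply: measurable_funX; apply: measurable_funB.
by apply: measurable_funX; apply: measurable_funB.
Qed.

Lemma leb2_disc (c z0 w0 t : R) :
  (mu \x mu)%E [set p | quad2 c z0 w0 p < t] = (pi * Num.max (t - c) 0)%:E.
Proof.
rewrite -(integral_sqrt_shift _ z0) /product_measure1.
apply: eq_integral => z _ /=.
rewrite -(lebesgue_measure_ball_sqr w0); congr (mu _).
apply/seteqP; split=> w; rewrite xsectionE /quad2 /=; lra.
Qed.

(** The image of the plane under [quad2] is [pi] times Lebesgue measure on the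
    half-line from [c]: the area of a disc is linear in the squared radius. *)
Lemma pushforward_quad2 (c z0 w0 : R) (A : set T1) : measurable A ->
  A `<=` `[c, +oo[ ->
  pushforward (mu \x mu)%E (quad2 c z0 w0) A = (pi%:E * mu A)%E.
Proof.
move=> mA Ac.
pose m1 := mscale (NngNum (pi_ge0 R)) (mrestr mu (measurable_itv `[c, +oo[)).
pose phi : {mfun (T1 * T1)%type >-> T1} :=
  HB.pack (quad2 c z0 w0) (isMeasurableFun.Build _ _ _ _ _ (measurable_quad2 c z0 w0)).
(* Both sides are compared as measures on the whole line, with the right-hand
   one restricted to the half-line. *)
suff -> : pushforward (mu \x mu)%E phi A = m1 A.
  by rewrite /m1 /mscale /= /mrestr setIidl.
have E x : pushforward (mu \x mu)%E phi `]-oo, x[ =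
    (pi * Num.max (x - c) 0)%:E.
  rewrite /pushforward (_ : _ @^-1` _ = [set p | quad2 c z0 w0 p < x]).
    exact: leb2_disc.
  by apply/seteqP; split=> p /=; rewrite in_itv.
have E1 x : m1 `]-oo, x[%classic = (pi * Num.max (x - c) 0)%:E.
  rewrite /m1 /mscale /= /mrestr EFinM; congr (_ * _)%E.
  rewrite (_ : _ `&` _ = `[c, x[%classic).
    rewrite lebesgue_measure_itv /= lte_fin -subr_gt0 -EFinB.
    by rewrite maxC /Num.max; case: ifPn.
  apply/seteqP; split=> v /=; rewrite !in_itv /= andbT.
    by move=> [-> ->].
  by move=> /andP[-> ->].
(* Open rays to the left form a pi-system generating the Borel sets. *)
apply: (@measure_unique _ R T1 (@RGenInftyO.G R)
  (fun k => `]-oo, k%:R[%classic) _ _ _ _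
  (pushforward (mu \x mu)%E phi)
  (mscale (NngNum (pi_ge0 R)) (mrestr mu (measurable_itv `[c, +oo[)))) => //.
- exact: RGenInftyO.measurableE.
- move=> _ _ [x ->] [y ->]; exists (Num.min x y).
  by apply/seteqP; split=> v /=; rewrite !in_itv /= lt_min => /andP.
- by move=> k; exists k%:R.
- apply/seteqP; split=> // v _; exists (Num.bound `|v|) => //=.
  rewrite in_itv /=; apply: le_lt_trans (ler_norm v) _.
  exact: archi_boundP.
- by move=> _ [x ->]; exact: etrans (E x) (esym (E1 x)).
- by move=> k; have := ltry (pi * Num.max (k%:R - c) 0); rewrite -(E k%:R).
Qed.

Lemma integral_leb2_quad (c z0 w0 : R) (g : T1 -> \bar R) :
  measurable_fun setT g -> (forall v, 0 <= g v)%E ->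
  (\int[mu \x mu]_p g (quad2 c z0 w0 p) = pi%:E * \int[mu]_(v in `[c, +oo[) g v)%E.
Proof.
move=> mg g0.
have D : quad2 c z0 w0 @^-1` `[c, +oo[ = setT.
  apply/seteqP; split=> // p _; rewrite /= in_itv /= andbT /quad2 -addrA.
  by rewrite lerDl addr_ge0 ?sqr_ge0.
pose phi : {mfun (T1 * T1)%type >-> T1} :=
  HB.pack (quad2 c z0 w0) (isMeasurableFun.Build _ _ _ _ _ (measurable_quad2 c z0 w0)).
rewrite -(ge0_integral_mscale _ _ (NngNum (pi_ge0 R))) //=; last first.
  exact: measurable_funTS.
rewrite -[in LHS]D -(ge0_integral_pushforward (measurable_quad2 c z0 w0)) //; last first.
  exact: measurable_funTS.
transitivity (\int[pushforward (mu \x mu) phi]_(y in `[c, +oo[) g y)%E => //.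
apply: eq_measure_integral => B mB Bc.
exact: pushforward_quad2.
Qed.

End Radial2.

(** * Polar coordinates in dimension four *)

Lemma sigma_finite_product d1 d2 (T1 : measurableType d1)
    (T2 : measurableType d2) (R : realType)
    (m1 : {sigma_finite_measure set T1 -> \bar R})
    (m2 : {sigma_finite_measure set T2 -> \bar R}) :
  sigma_finite setT (m1 \x m2)%E.
Proof.
have [F FT Foo] := sigma_finiteT m1; have [G GT Goo] := sigma_finiteT m2.
(* Pairs of indices are enumerated by their natural-number codes. *)
pose p n := odflt (0, 0)%N (unpickle n : option (nat * nat)).
exists (fun n => F (p n).1 `*` G (p n).2).
  apply/seteqP; split=> // -[x y] _.
  have /= [i _ Fi] : (\bigcup_i F i) x by rewrite -FT.
  have /= [j _ Gj] : (\bigcup_i G i) y by rewrite -GT.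
  by exists (pickle (i, j)) => //; rewrite /p pickleK.
move=> n; have [mF Fn] := Foo (p n).1; have [mG Gn] := Goo (p n).2.
split; first exact: measurableX.
by rewrite product_measure1E // lte_mul_pinfty // ge0_fin_numE.
Qed.

Section Radial4.
Context {R : realType}.
Notation mu := (@lebesgue_measure R).
Notation T1 := (measurableTypeR R).

Lemma sqdist_quad2 (y x : R4 R) : sqdist y x =
  quad2 (quad2 0 y.1.1.1 y.1.1.2 x.1.1) y.1.2 y.2 (x.1.2, x.2).
Proof. by rewrite sqdistE /quad2 /= add0r. Qed.

Lemma measurable_sqdist (y : R4 R) : measurable_fun setT (sqdist y : Leb4 R -> T1).
Proof. exact: smooth_measurable (smooth_sqdist y). Qed.

Let below : set (T1 * T1) := [set p | p.1 <= p.2].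

Let wedge : set (T1 * T1) := [set p | 0 <= p.1 /\ p.1 <= p.2].

Let measurable_below : measurable below.
Proof.
have mb : measurable_fun setT (fun p : T1 * T1 => p.1 <= p.2).
  exact: measurable_fun_ler.
have := mb measurableT [set true] I.
by rewrite setTI.
Qed.

Let measurable_wedge : measurable wedge.
Proof.
have mb : measurable_fun setT (fun p : T1 * T1 => (0 : R) <= p.1).
  exact: measurable_fun_ler.
have := mb measurableT [set true] I.
by rewrite setTI => m0; exact: measurableI m0 measurable_below.
Qed.

Let measurable_indic_g (A : set (T1 * T1)) (g : T1 -> \bar R) :
  measurable A -> measurable_fun setT g ->
  measurable_fun setT (fun p : T1 * T1 => (\1_A p)%:E * g p.2)%E.
Proof.
move=> mA mg; apply: emeasurable_funM; last exact: measurableT_comp.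
by apply/measurable_EFinP; exact: measurable_indic.
Qed.

Let integral_below (g : T1 -> \bar R) s :
  (\int[mu]_(v in `[s, +oo[) g v = \int[mu]_v ((\1_below (s, v))%:E * g v))%E.
Proof.
rewrite integral_mkcond; apply: eq_integral => v _; rewrite patchE indicE.
case: ifPn => [|]; rewrite ?inE ?notin_setE /= in_itv /= andbT => sv.
  by rewrite mem_set ?mul1e.
by rewrite memNset ?mul0e //; exact/negP.
Qed.

Lemma measurable_tail_integral (g : T1 -> \bar R) :
  measurable_fun setT g -> (forall v, 0 <= g v)%E ->
  measurable_fun setT (fun s : T1 => \int[mu]_(v in `[s, +oo[) g v)%E.
Proof.
move=> mg g0; under eq_fun do rewrite integral_below.
apply: (measurable_fun_fubini_tonelli_F (m2 := mu)
  (fun p : T1 * T1 => (\1_below p)%:E * g p.2)%E).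
  exact: measurable_indic_g.
by move=> p; rewrite mule_ge0 // lee_fin.
Qed.

(** Exchanging the order of integration over the wedge [0 <= s <= v] turns the
    convolution square of the constant density on the half-line into the
    density [v]. *)
Lemma integral_tail_integral (g : T1 -> \bar R) :
  measurable_fun setT g -> (forall v, 0 <= g v)%E ->
  (\int[mu]_(s in `[0%R, +oo[) \int[mu]_(v in `[s, +oo[) g v =
   \int[mu]_(v in `[0%R, +oo[) (v%:E * g v))%E.
Proof.
move=> mg g0.
have L (v : R) : mu `[0%R, v] = (if (0 < v)%R then v%:E else 0)%E.
  by rewrite lebesgue_measure_itv /= lte_fin; case: ifP; rewrite ?EFinN ?sube0.
pose k (p : T1 * T1) := ((\1_wedge p)%:E * g p.2)%E.
have mk : measurable_fun setT k by exact: measurable_indic_g.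
have k0 p : (0 <= k p)%E by rewrite mule_ge0 // lee_fin.
transitivity (\int[mu]_s \int[mu]_v k (s, v))%E.
  rewrite integral_mkcond; apply: eq_integral => s _; rewrite patchE.
  case: ifPn => [|]; rewrite ?inE ?notin_setE /= in_itv /= andbT => s0.
    rewrite integral_below; apply: eq_integral => v _; rewrite /k !indicE.
    congr ((_ : bool)%:R%:E * _)%E.
    by apply/idP/idP; rewrite !inE; [split|case].
  rewrite integral0_eq // => v _; rewrite /k indicE memNset ?mul0e //.
  by case=> s0' _; exact: s0.
rewrite (@fubini_tonelli _ _ _ _ _ mu mu k mk k0).
rewrite [RHS]integral_mkcond; apply: eq_integral => v _; rewrite patchE.
have -> : (fun s => k (s, v)) = (fun s => (\1_`[0%R, v] s)%:E * g v)%E.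
  apply/funext => s; rewrite /k !indicE; congr ((_ : bool)%:R%:E * _)%E.
  apply/idP/idP; rewrite !inE /= in_itv /=; first by case=> -> ->.
  by move=> /andP.
rewrite ge0_integralZr //; last first.
  by apply/measurable_EFinP; exact: measurable_indic.
rewrite integral_indic // setIT [X in (X * _)%E](L v).
case: ifPn => v0; case: ifPn => // v1.
- by move: v1; rewrite notin_setE /= in_itv /= andbT => /negP; rewrite ltW.
- move: v1; rewrite inE /= in_itv /= andbT => v1.
  by rewrite (_ : v = 0) //; apply/eqP; rewrite eq_le v1 leNgt v0.
- by rewrite mul0e.
Qed.

(** Names for the partial products, which carry the sigma-finiteness used by
    each application of Tonelli's theorem. *)
Definition leb2 : set (T1 * T1) -> \bar R := (mu \x mu)%E.

HB.instance Definition _ := Measure.on leb2.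

HB.instance Definition _ := Measure_isSigmaFinite.Build _ _ _ leb2
  (sigma_finite_product mu mu).

Definition leb3 : set (T1 * T1 * T1) -> \bar R := (leb2 \x mu)%E.

HB.instance Definition _ := Measure.on leb3.

HB.instance Definition _ := Measure_isSigmaFinite.Build _ _ _ leb3
  (sigma_finite_product leb2 mu).

Lemma tonelli_leb4 (f : Leb4 R -> \bar R) :
  measurable_fun setT f -> (forall x, 0 <= f x)%E ->
  (\int[leb4 R]_x f x =
   \int[mu \x mu]_p \int[mu \x mu]_q f (p, q.1, q.2))%E.
Proof.
move=> mf f0.
pose F (x : T1 * T1 * T1) := (\int[mu]_w f (x, w))%E.
have mF : measurable_fun setT F.
  exact: (@measurable_fun_fubini_tonelli_F _ _ _ _ _ _ f mf f0).
have F0 x : (0 <= F x)%E by exact: integral_ge0.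
transitivity (\int[leb3]_x F x)%E.
  exact: (@fubini_tonelli1 _ _ _ _ _ leb3 mu f mf f0).
transitivity (\int[leb2]_p \int[mu]_z F (p, z))%E.
  exact: (@fubini_tonelli1 _ _ _ _ _ leb2 mu F mF F0).
apply: eq_integral => p _.
have mq : measurable_fun setT (fun q : T1 * T1 => f (p, q.1, q.2)).
  apply: (measurableT_comp mf).
  apply: measurable_fun_pair; last exact: measurable_snd.
  by apply: measurable_fun_pair; [exact: measurable_cst|exact: measurable_fst].
apply/esym.
exact: (@fubini_tonelli1 _ _ _ _ _ mu mu (fun q : T1 * T1 => f (p, q.1, q.2)) mq).
Qed.

(** Polar coordinates in dimension four, written for the squared radius [v]:
    the plane formula is applied twice. *)
Lemma integral_leb4_radial (y : R4 R) (g : T1 -> \bar R) :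
  measurable_fun setT g -> (forall v, 0 <= g v)%E ->
  (\int[leb4 R]_x g (sqdist y x) =
   (pi ^+ 2)%:E * \int[mu]_(v in `[0%R, +oo[) (v%:E * g v))%E.
Proof.
move=> mg g0.
pose f (x : Leb4 R) := g (sqdist y x).
have mf : measurable_fun setT f.
  exact: (measurableT_comp mg (measurable_sqdist y)).
have f0 x : (0 <= f x)%E by exact: g0.
pose H (s : T1) := (pi%:E * \int[mu]_(v in `[s, +oo[) g v)%E.
have mH : measurable_fun setT H.
  by apply: measurable_funeM; exact: measurable_tail_integral.
have H0 s : (0 <= H s)%E.
  by rewrite mule_ge0 ?lee_fin ?pi_ge0 //; exact: integral_ge0.
rewrite (tonelli_leb4 mf f0).
transitivity (\int[mu \x mu]_p H (quad2 0 y.1.1.1 y.1.1.2 p))%E.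
  apply: eq_integral => p _; rewrite /H -(integral_leb2_quad _ y.1.2 y.2) //.
  by apply: eq_integral => q _; rewrite /f sqdist_quad2.
rewrite integral_leb2_quad // -integral_tail_integral // EFinM -muleA.
congr (_ * _)%E; apply: ge0_integralZl => //.
- by apply: measurable_funTS; exact: measurable_tail_integral.
- by move=> s _; exact: integral_ge0.
- by rewrite lee_fin pi_ge0.
Qed.

End Radial4.

(** * Integrals of radial kernels over balls *)

Section BallIntegrals.
Context {R : realType}.
Notation mu := (@lebesgue_measure R).
Notation T1 := (measurableTypeR R).
Implicit Types (y : R4 R) (a b : R).

Definition sqball y b : set (Leb4 R) := [set x | sqdist y x < b].

Lemma measurable_sqball y b : measurable (sqball y b).
Proof.
have mb : measurable_fun setT (fun x : Leb4 R => sqdist y x < b).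
  apply: measurable_fun_ltr; last exact: measurable_cst.
  exact: measurable_sqdist.
have := mb measurableT [set true] I.
by rewrite setTI.
Qed.

(** Polar coordinates followed by the fundamental theorem of calculus; [v * h v]
    is the integrand because the area of the sphere contributes the density
    [v]. *)
Lemma integral_sqball y b (h F : R -> R) : 0 < b ->
  measurable_fun setT (h : T1 -> R) ->
  (forall v, 0 <= v -> 0 <= h v) ->
  (forall v, 0 <= v -> {for v, continuous h}) ->
  (forall v : R, 0 <= v -> is_derive v (1 : R) F (v * h v)) ->
  (\int[leb4 R]_x (\1_(sqball y b) x * h (sqdist y x))%R%:E =
   (pi ^+ 2 * (F b - F 0))%R%:E)%E.
Proof.
move=> b0 mh h0 ch dF.
pose g (v : T1) := (\1_(`[0%R, b[%classic : set T1) v * h v)%:E.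
have mg : measurable_fun setT g.
  apply/measurable_EFinP; apply: measurable_funM => //.
have g0 v : (0 <= g v)%E.
  rewrite lee_fin indicE; have [|_] := boolP (v \in _); last by rewrite mul0r.
  by rewrite inE /= in_itv /= => /andP[v0 _]; rewrite mul1r h0.
transitivity (\int[leb4 R]_x g (sqdist y x))%E.
  apply: eq_integral => x _; rewrite /g !indicE; congr (EFin ((_ : bool)%:R * _)%R).
  by apply/idP/idP; rewrite !inE /= in_itv /= sqdist_ge0.
rewrite integral_leb4_radial // [RHS]EFinM; congr (_ * _)%E.
transitivity (\int[mu]_(v in `[0%R, b]) (v * h v)%:E)%E; last first.
  rewrite (@continuous_FTC2 _ (fun v => v * h v) F) //.
  - apply: continuous_in_subspaceT => v; rewrite inE /= in_itv /= => /andP[v0 _].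
    by apply: continuousM; [exact: cvg_id|exact: ch].
  - have cF v : 0 <= v -> {for v, continuous F}.
      move=> v0; apply/differentiable_continuous/derivable1_diffP.
      by case: (dF v v0).
    split.
    + by move=> v; rewrite in_itv /= => /andP[v0 _]; case: (dF v (ltW v0)).
    + exact/cvg_at_right_filter/cF.
    + exact/cvg_at_left_filter/cF/ltW.
  - move=> v; rewrite in_itv /= => /andP[v0 _]; rewrite derive1E.
    by case: (dF v (ltW v0)).
rewrite -integral_itv_bndo_bndc; last first.
  apply/measurable_EFinP; apply: measurable_funTS; exact: measurable_funM.
rewrite integral_mkcond [RHS]integral_mkcond; apply: eq_integral => v _.
rewrite !patchE /g indicE; have [|] := boolP (v \in `[0, b[%classic).
  rewrite inE /= in_itv /= => /andP[v0 _].
  by rewrite mem_set ?mul1r // /= in_itv /= v0.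
by move=> _; rewrite mul0r mule0 if_same.
Qed.

Let is_derive_shift a (v : R) : is_derive v (1 : R) (fun w : R => w + a) 1.
Proof.
have := is_deriveD (is_derive_id v (1 : R)) (is_derive_cst a v (1 : R)).
by rewrite addr0.
Qed.

Let is_derive_shiftV a (v : R) : 0 < v + a ->
  is_derive v (1 : R) (fun w : R => (w + a)^-1) (- (v + a)^-1 ^+ 2).
Proof.
move=> va; have va0 : v + a != 0 by rewrite gt_eqF.
have dV := is_deriveV (f := fun w : R => w + a) va0 (is_derive_shift a v).
by apply: is_derive_eq dV _; rewrite /GRing.scale /= mulr1 exprVn.
Qed.

Let continuous_shiftV a v : 0 < v + a ->
  {for v, continuous (fun w : R => (w + a)^-1)}.
Proof.
move=> va; apply/differentiable_continuous/derivable1_diffP.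
by case: (is_derive_shiftV va).
Qed.

Let measurable_shiftV a : measurable_fun setT (fun w : T1 => (w + a)^-1).
Proof.
have ms : measurable_fun setT (fun w : T1 => w + a) by exact: measurable_funD.
(* Both sides are 0 where [w + a = 0], the inverse of 0 being 0. *)
have -> : (fun w : T1 => (w + a)^-1) =
    (fun w => (w + a) * ((w + a) ^+ 2) `^ (-1)).
  apply/funext => w; have [->|wa0] := eqVneq (w + a) 0.
    by rewrite invr0 mul0r.
  by rewrite powR_inv1 ?sqr_ge0 // expr2 invfM mulrA divff // mul1r.
apply: measurable_funM => //.
by apply: (measurableT_comp (measurable_powR (-1))); exact: measurable_funX.
Qed.

Lemma leb4_sqball y b : 0 < b ->
  leb4 R (sqball y b) = (pi ^+ 2 * (b ^+ 2 / 2))%:E.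
Proof.
move=> b0.
have dF (v : R) : 0 <= v ->
    is_derive v (1 : R) (fun v : R => v * v * 2^-1) (v * cst 1 v).
  move=> _; have dM := is_deriveM (is_derive_id v (1 : R)) (is_derive_id v (1 : R)).
  have dd := is_deriveM dM (is_derive_cst (2^-1 : R) v (1 : R)).
  by apply: is_derive_eq dd _; rewrite /GRing.scale /=; lra.
transitivity (\int[leb4 R]_x (\1_(sqball y b) x * cst 1 (sqdist y x))%R%:E)%E.
  under eq_integral do rewrite /= mulr1.
  by rewrite integral_indic ?setIT //; exact: measurable_sqball.
rewrite (@integral_sqball y b (cst 1) _ b0 _ _ _ dF) //.
- by rewrite !mul0r subr0.
- by move=> v _; exact: cst_continuous.
Qed.

(** As [b / a] grows, the mass tends to [4 pi ^ 2]: after normalisation the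
    kernel is an approximate identity at the scale [a]. *)
Lemma integral_kernel y a b : 0 < a -> 0 < b ->
  (\int[leb4 R]_x (\1_(sqball y b) x *
     (8 * a * (sqdist y x + a)^-1 ^+ 3))%R%:E =
   (4 * pi ^+ 2 * (b / (b + a)) ^+ 2)%R%:E)%E.
Proof.
move=> a0 b0.
have dF (v : R) : 0 <= v -> is_derive v (1 : R)
    (fun v => 4 * (v * v) * ((v + a)^-1 * (v + a)^-1))
    (v * (8 * a * (v + a)^-1 ^+ 3)).
  move=> v0; have va : 0 < v + a by rewrite ltr_wpDl.
  have dV := is_derive_shiftV va.
  have dM := is_deriveZ (4 : R)
    (is_deriveM (is_derive_id v (1 : R)) (is_derive_id v (1 : R))).
  have dd := is_deriveM dM (is_deriveM dV dV).
  apply: is_derive_eq dd _.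
  rewrite [X in X *: _](_ : _ = 4 * (v * v)) //.
  by rewrite /GRing.scale !fctE /=; field; rewrite gt_eqF.
rewrite (@integral_sqball y b (fun v => 8 * a * (v + a)^-1 ^+ 3) _ b0 _ _ _ dF).
- by rewrite !mulr0 mul0r subr0 expr2; congr EFin; ring.
- apply: measurable_funM; first exact: measurable_cst.
  exact: measurable_funX.
- move=> v v0; have va : 0 <= v + a by rewrite addr_ge0 // ltW.
  apply: mulr_ge0; first by rewrite mulr_ge0 // ltW.
  by rewrite exprn_ge0 // invr_ge0.
- move=> v v0.
  have c1 := continuous_shiftV (ltr_wpDl v0 a0).
  have c0 : {for v, continuous (fun=> 8 * a : R)} by exact: cst_continuous.
  exact: (continuousM c0 (continuousM c1 (continuousM c1 c1))).
Qed.

(** The only integral that is unbounded as [a] tends to 0; its constant is the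
    one that enters the final estimate. *)
Lemma integral_log_kernel y a b : 0 < a -> 0 < b ->
  (\int[leb4 R]_x (\1_(sqball y b) x * (sqdist y x + a)^-1 ^+ 2)%R%:E <=
   (pi ^+ 2 * ln (1 + b / a))%R%:E)%E.
Proof.
move=> a0 b0.
have dF (v : R) : 0 <= v -> is_derive v (1 : R)
    (fun v => ln (v + a) + a * (v + a)^-1) (v * (v + a)^-1 ^+ 2).
  move=> v0; have va : 0 < v + a by rewrite ltr_wpDl.
  have dl := is_derive1_comp (g := fun w : R => w + a)
    (is_derive1_ln va) (is_derive_shift a v).
  have dV := is_deriveZ a (is_derive_shiftV va).
  apply: is_derive_eq (is_deriveD dl dV) _.
  by rewrite /GRing.scale /=; field; rewrite gt_eqF.
rewrite (@integral_sqball y b (fun v => (v + a)^-1 ^+ 2) _ b0 _ _ _ dF).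
- rewrite lee_fin ler_wpM2l ?sqr_ge0 // add0r divff ?gt_eqF //.
  have -> : 1 + b / a = (b + a) / a by field; rewrite gt_eqF.
  rewrite ln_div ?posrE // ?addr_gt0 //.
  suff : a * (b + a)^-1 <= 1 by lra.
  by rewrite ler_pdivrMr ?addr_gt0 // mul1r lerDr ltW.
- exact: measurable_funX.
- by move=> v v0; exact: sqr_ge0.
- move=> v v0; have c1 := continuous_shiftV (ltr_wpDl v0 a0).
  exact: (continuousM c1 c1).
Qed.

(** Since [s < 1], the integrand decays fast enough for a bound uniform in
    [b]; the power [a ^ s] is forced by scaling. *)
Lemma integral_kernel_powR y a b s : 0 < a -> 0 < b -> 0 < s < 2^-1 ->
  (\int[leb4 R]_x (\1_(sqball y b) x *
     (8 * a * (sqdist y x + a)^-1 ^+ 3 * (sqdist y x + a) `^ s))%R%:E <=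
   (16 * pi ^+ 2 * a `^ s)%R%:E)%E.
Proof.
move=> a0 b0 /andP[s0 s2].
have dP v : 0 < v + a -> is_derive v (1 : R) (fun v : R => (v + a) `^ s)
    (s * ((v + a) `^ s * (v + a)^-1)).
  move=> va.
  have dl := is_derive1_comp (g := fun w : R => w + a)
    (is_derive1_powR s va) (is_derive_shift a v).
  apply: is_derive_eq dl _.
  by rewrite mulr1 powRD ?powR_inv1 ?ltW // (gt_eqF va) implybT.
(* From [v (v + a) ^ (s - 3) = (v + a) ^ (s - 2) - a (v + a) ^ (s - 3)]. *)
pose F (v : R) := 8 * a * ((v + a) `^ s *
  ((s - 1)^-1 * (v + a)^-1 - a * (s - 2)^-1 * ((v + a)^-1 * (v + a)^-1))).
have s1 : s - 1 != 0 by rewrite lt_eqF //; lra.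
have s2' : s - 2 != 0 by rewrite lt_eqF //; lra.
have dF (v : R) : 0 <= v -> is_derive v (1 : R) F
    (v * (8 * a * (v + a)^-1 ^+ 3 * (v + a) `^ s)).
  move=> v0; have va : 0 < v + a by rewrite ltr_wpDl.
  have dV := is_derive_shiftV va.
  have d1 := is_deriveZ (s - 1)^-1 dV.
  have d2 := is_deriveZ (a * (s - 2)^-1) (is_deriveM dV dV).
  have dd := is_deriveZ (8 * a) (is_deriveM (dP v va) (is_deriveB d1 d2)).
  apply: is_derive_eq dd _.
  rewrite [X in _ + X *: _](_ : _ = (s - 1)^-1 * (v + a)^-1
    - a * (s - 2)^-1 * ((v + a)^-1 * (v + a)^-1)) //.
  rewrite /GRing.scale ?fctE /=; field.
  by rewrite s1 s2' (gt_eqF va).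
rewrite (@integral_sqball y b
  (fun v => 8 * a * (v + a)^-1 ^+ 3 * (v + a) `^ s) _ b0 _ _ _ dF).
- rewrite lee_fin [leRHS]mulrAC [leRHS]mulrC ler_wpM2l ?sqr_ge0 //.
  have A0 : 0 <= a `^ s := powR_ge0 _ _.
  have p1 : 0 < 1 - s by lra.
  have p2 : 0 < 2 - s by lra.
  have F0E : F 0 = - (8 * a `^ s * ((1 - s)^-1 * (2 - s)^-1)).
    rewrite /F add0r; field.
    by rewrite s1 s2' (gt_eqF p1) (gt_eqF p2) (gt_eqF a0).
  have Fb : F b <= 0.
    have ba : 0 < b + a by rewrite addr_gt0.
    have -> : F b = - (8 * a * (b + a) `^ s * (b + a)^-1 *
        ((1 - s)^-1 - (2 - s)^-1 * (a * (b + a)^-1))).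
      rewrite /F; field.
      by rewrite s1 s2' (gt_eqF p1) (gt_eqF p2) (gt_eqF ba).
    rewrite oppr_le0 mulr_ge0 //.
      by rewrite !mulr_ge0 ?powR_ge0 ?invr_ge0 // ltW.
    have r1 : a * (b + a)^-1 <= 1.
      by rewrite ler_pdivrMr ?addr_gt0 // mul1r lerDr ltW.
    rewrite subr_ge0 (@le_trans _ _ (2 - s)^-1) //.
      by rewrite ger_pMr ?invr_gt0.
    by rewrite lef_pV2 ?posrE //; lra.
  have q1 : (1 - s)^-1 <= 2 by rewrite invf_ple ?posrE //; lra.
  have q2 : (2 - s)^-1 <= 1 by rewrite invf_ple ?posrE //; lra.
  have q : (1 - s)^-1 * (2 - s)^-1 <= 2 * 1.
    by apply: ler_pM; rewrite ?invr_ge0 // ltW.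
  by rewrite F0E; nra.
- apply: measurable_funM.
    apply: measurable_funM; first exact: measurable_cst.
    exact: measurable_funX.
  apply: (measurableT_comp (measurable_powR s)); exact: measurable_funD.
- move=> v v0; have va : 0 <= v + a by rewrite addr_ge0 // ltW.
  apply: mulr_ge0; last exact: powR_ge0.
  apply: mulr_ge0; first by rewrite mulr_ge0 // ltW.
  by rewrite exprn_ge0 // invr_ge0.
- move=> v v0; have va : 0 < v + a by rewrite ltr_wpDl.
  have c1 := continuous_shiftV va.
  have c2 : {for v, continuous (fun w : R => (w + a) `^ s)}.
    apply/differentiable_continuous/derivable1_diffP.
    by case: (dP v va).
  have c0 : {for v, continuous (fun=> 8 * a : R)} by exact: cst_continuous.
  exact: (continuousM (continuousM c0 (continuousM c1 (continuousM c1 c1))) c2).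
Qed.

End BallIntegrals.

(** * Square integrable fields *)

Section L2.
Context d {T : measurableType d} {R : realType} (m : {measure set T -> \bar R}).
Implicit Types f g : T -> R.

Lemma Lnorm2_integral f : ('N[m]_2%:E[EFin \o f] < +oo)%E ->
  (\int[m]_x (f x ^+ 2)%:E = (fine 'N[m]_2%:E[EFin \o f] ^+ 2)%:E)%E.
Proof.
move=> foo.
have nf : ('N[m]_2%:E[EFin \o f] \is a fin_num)%E.
  by rewrite ge0_fin_numE // Lnorm_ge0.
have r0 : 0 <= fine ('N[m]_2%:E[EFin \o f])%E by rewrite fine_ge0 // Lnorm_ge0.
rewrite -powR_mulrn // -poweR_EFin fineK // poweR_Lnorm ?pnatr_eq0 //.
apply: eq_integral => x _ /=.
by rewrite powR_mulrn // real_normK ?num_real.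
Qed.

Lemma Lnorm2_le f A : 0 <= A ->
  (\int[m]_x (f x ^+ 2)%:E <= (A ^+ 2)%:E)%E ->
  ('N[m]_2%:E[EFin \o f] <= A%:E)%E.
Proof.
move=> A0 fA.
have -> : A%:E = ((A ^+ 2)%:E `^ 2^-1)%E.
  by rewrite poweR_EFin -powR_mulrn // -powRrM divff // powRr1.
rewrite unlock; apply: gt0_ler_poweR; rewrite ?invr_ge0 //.
- rewrite in_itv /= leey andbT; apply: integral_ge0 => x _.
  by rewrite ?lee_fin ?poweR_ge0 ?powR_ge0.
- by rewrite in_itv /= leey andbT lee_fin sqr_ge0.
- rewrite (eq_integral (fun x => (f x ^+ 2)%:E)) // => x _ /=.
  by rewrite powR_mulrn // real_normK ?num_real.
Qed.

Lemma cauchy_schwarz f g A B :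
  measurable_fun setT f -> measurable_fun setT g -> 0 <= A -> 0 <= B ->
  (\int[m]_x (f x ^+ 2)%:E <= (A ^+ 2)%:E)%E ->
  (\int[m]_x (g x ^+ 2)%:E <= (B ^+ 2)%:E)%E ->
  (\int[m]_x `|f x * g x|%:E <= (A * B)%:E)%E.
Proof.
move=> mf mg A0 B0 fA gB.
have h : (2^-1 + 2^-1 = 1 :> R)%R by rewrite -div1r -splitr.
have := @hoelder _ _ _ m f g 2 2 mf mg (ltr0n _ 2) (ltr0n _ 2) h.
rewrite Lnorm1 => /le_trans; apply.
by rewrite EFinM; apply: lee_pmul; rewrite ?Lnorm_ge0 // Lnorm2_le.
Qed.

Lemma integrable_mul_L2 f g A B :
  measurable_fun setT f -> measurable_fun setT g -> 0 <= A -> 0 <= B ->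
  (\int[m]_x (f x ^+ 2)%:E <= (A ^+ 2)%:E)%E ->
  (\int[m]_x (g x ^+ 2)%:E <= (B ^+ 2)%:E)%E ->
  m.-integrable setT (EFin \o (fun x => f x * g x)).
Proof.
move=> mf mg A0 B0 fA gB; apply/integrableP; split.
  by apply/measurable_EFinP; exact: measurable_funM.
exact: le_lt_trans (cauchy_schwarz mf mg A0 B0 fA gB) (ltry _).
Qed.

Lemma Rintegral_mul_L2_le f g A B :
  measurable_fun setT f -> measurable_fun setT g -> 0 <= A -> 0 <= B ->
  (\int[m]_x (f x ^+ 2)%:E <= (A ^+ 2)%:E)%E ->
  (\int[m]_x (g x ^+ 2)%:E <= (B ^+ 2)%:E)%E ->
  `|\int[m]_x (f x * g x)| <= A * B.
Proof.
move=> mf mg A0 B0 fA gB.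
have fg := integrable_mul_L2 mf mg A0 B0 fA gB.
apply: le_trans (le_normr_Rintegral measurableT fg) _.
rewrite -lee_fin /Rintegral fineK; first exact: cauchy_schwarz.
rewrite ge0_fin_numE; last by apply: integral_ge0 => x _; rewrite lee_fin.
exact: le_lt_trans (cauchy_schwarz mf mg A0 B0 fA gB) (ltry _).
Qed.

End L2.

Section SquareIntegrable4.
Context {R : realType}.
Notation T1 := (measurableTypeR R).
Implicit Types (u f g : R4 R -> R) (x y : R4 R) (alpha b : R) (i : 'I_4).

Definition nrm2 u : R := fine (LpNorm 2%:E u).

Lemma nrm2_ge0 u : 0 <= nrm2 u.
Proof. by rewrite fine_ge0 // Lnorm_ge0. Qed.

Lemma in_L2_integral u : in_L2 u ->
  (\int[leb4 R]_x (u x ^+ 2)%:E = (nrm2 u ^+ 2)%:E)%E.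
Proof. by case=> _; exact: Lnorm2_integral. Qed.

Lemma in_L2D u f : in_L2 u -> in_L2 f -> in_L2 (fun x => u x + f x).
Proof.
move=> [mu u2] [mf f2]; split; first exact: measurable_funD.
apply: le_lt_trans (lte_add_pinfty u2 f2).
have o2 : 1 <= 2 :> R by rewrite ler1n.
exact: (@minkowski_EFin _ _ _ (leb4 R) u f 2 mu mf o2).
Qed.

Lemma ball_indic_L2 y b : 0 < b ->
  (\int[leb4 R]_x ((\1_(sqball y b) x : R) ^+ 2)%:E =
   ((pi * Num.sqrt (b ^+ 2 / 2)) ^+ 2)%:E)%E.
Proof.
move=> b0; rewrite exprMn sqr_sqrtr ?divr_ge0 ?sqr_ge0 //.
rewrite -(leb4_sqball y b0) -[sqball y b in RHS]setIT.
rewrite -integral_indic //; last exact: measurable_sqball.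
apply: eq_integral => x _.
by rewrite indicE; case: (_ \in _); rewrite ?expr1n ?expr0n.
Qed.

(** The square is dominated by [M ^ 2] times the indicator of the ball. *)
Lemma bounded_ball_L2 f y b M :
  measurable_fun setT (f : Leb4 R -> R) -> 0 < b -> 0 <= M ->
  (forall x, b <= sqdist y x -> f x = 0) -> (forall x, `|f x| <= M) ->
  exists2 B, 0 <= B & (\int[leb4 R]_x (f x ^+ 2)%:E <= (B ^+ 2)%:E)%E.
Proof.
move=> mf b0 M0 f0 fM.
exists (M * (pi * Num.sqrt (b ^+ 2 / 2))).
  by rewrite !mulr_ge0 ?pi_ge0.
have mi : measurable_fun setT (fun x : Leb4 R => (\1_(sqball y b) x : R) ^+ 2).
  by apply: measurable_funX; apply: measurable_indic; exact: measurable_sqball.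
rewrite exprMn EFinM -(ball_indic_L2 y b0) -ge0_integralZl //; last 2 first.
- exact/measurable_EFinP.
- by rewrite lee_fin sqr_ge0.
apply: ge0_le_integral => //.
- by move=> x _; rewrite lee_fin sqr_ge0.
- by apply/measurable_EFinP; exact: measurable_funX.
- by apply: measurable_funeM; exact/measurable_EFinP.
move=> x _; rewrite -EFinM lee_fin indicE.
have [xb|xb] := boolP (x \in sqball y b).
  rewrite expr1n mulr1 -real_normK ?num_real //.
  by rewrite lerXn2r ?nnegrE.
rewrite f0 ?expr0n ?mulr0 // leNgt.
by move: xb; rewrite notin_setE => /negP.
Qed.

End SquareIntegrable4.

(** * Holder continuous fields and the weak Laplacian *)

Section Holder.
Context {R : realType}.
Notation T1 := (measurableTypeR R).
Implicit Types (u f g : R4 R -> R) (x y : R4 R) (alpha b : R).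

Lemma enorm_sqdist x y : enorm (x - y) = Num.sqrt (sqdist y x).
Proof.
rewrite /enorm /sqdist; congr Num.sqrt; apply: eq_bigr => i _.
by congr (_ ^+ 2); move: i; elim/ord4P.
Qed.

Lemma sqdist_eq0 x y : sqdist y x = 0 -> x = y.
Proof.
move=> /eqP; rewrite /sqdist psumr_eq0 => [/allP h|i _]; last exact: sqr_ge0.
have {}h i : coord i x = coord i y.
  by apply/eqP; rewrite -subr_eq0 -sqrf_eq0; apply: h; rewrite mem_index_enum.
case: x y h => [[[a b] c] d] [[[a' b'] c'] d'] h.
have h0 : a = a' := h 0; have h1 : b = b' := h 1.
have h2 : c = c' := h 2; have h3 : d = d' := h 3.
by rewrite h0 h1 h2 h3.
Qed.

Lemma leb4_setT_gt0 : (0 < leb4 R setT)%E.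
Proof.
apply: (@lt_le_trans _ _ (leb4 R (sqball 0 1))); last first.
  by apply: le_measure; rewrite ?inE //; exact: measurable_sqball.
by rewrite leb4_sqball // lte_fin mulr_gt0 ?exprn_gt0 ?pi_gt0 // divr_gt0.
Qed.

Lemma LinftyE u : LpNorm +oo u = ess_sup (leb4 R) (abse \o (EFin \o u)).
Proof. by rewrite /LpNorm unlock leb4_setT_gt0. Qed.

Lemma Linfty_le u K : (forall x, `|u x| <= K) -> (LpNorm +oo u <= K%:E)%E.
Proof.
move=> uK; rewrite LinftyE; apply/ess_supP; apply: nearW => x /=.
by rewrite lee_fin.
Qed.

Lemma holder_seminorm_ge0 alpha u : (0 <= holder_seminorm alpha u)%E.
Proof.
pose e : R4 R := basis4 R 0.
have e0 : e != 0.
  apply/eqP => /(congr1 (fun x : R4 R => x.1.1.1)) /= /eqP.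
  by rewrite oner_eq0.
apply: (@le_trans _ _ (`|u e - u 0| / enorm (e - 0) `^ alpha)%:E).
  by rewrite lee_fin divr_ge0 ?powR_ge0.
by apply: ereal_sup_ubound; exists (e, 0).
Qed.

Section holder_facts.
Variables (alpha : R) (u : R4 R -> R).
Hypotheses (alpha0 : 0 < alpha) (hu : holder alpha u).

Let Linfty_ge0 : (0 <= LpNorm +oo u)%E. Proof. exact: Lnorm_ge0. Qed.

Lemma holder_Linfty_fin : LpNorm +oo u \is a fin_num.
Proof.
rewrite ge0_fin_numE //; apply: le_lt_trans hu.
by rewrite /holder_norm leeDl // holder_seminorm_ge0.
Qed.

Lemma holder_seminorm_fin : holder_seminorm alpha u \is a fin_num.
Proof.
rewrite ge0_fin_numE ?holder_seminorm_ge0 //; apply: le_lt_trans hu.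
by rewrite /holder_norm leeDr.
Qed.

Lemma fine_holder_norm : fine (holder_norm alpha u) =
  fine (LpNorm +oo u) + fine (holder_seminorm alpha u).
Proof.
by rewrite /holder_norm fineD ?holder_Linfty_fin ?holder_seminorm_fin.
Qed.

Lemma holder_le x y :
  `|u x - u y| <= fine (holder_seminorm alpha u) * sqdist y x `^ (alpha / 2).
Proof.
have [->|xy] := eqVneq x y.
  by rewrite subrr normr0 mulr_ge0 ?powR_ge0 // fine_ge0 // holder_seminorm_ge0.
have q0 : 0 < sqdist y x.
  rewrite lt_neqAle sqdist_ge0 andbT eq_sym.
  by apply: contra xy => /eqP /sqdist_eq0 ->.
have -> : sqdist y x `^ (alpha / 2) = enorm (x - y) `^ alpha.
  by rewrite enorm_sqdist -powR12_sqrt ?sqdist_ge0 // -powRrM mulrC.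
rewrite -ler_pdivrMr; last first.
  by rewrite powR_gt0 // enorm_sqdist sqrtr_gt0.
rewrite -lee_fin fineK ?holder_seminorm_fin //.
by apply: ereal_sup_ubound; exists (x, y).
Qed.

(** The essential supremum controls every value: were it exceeded at a point,
    it would be exceeded on a ball, which has positive measure. *)
Lemma le_Linfty y : `|u y| <= fine (LpNorm +oo u).
Proof.
rewrite leNgt; apply/negP => uM.
set M := fine _ in uM; set S := fine (holder_seminorm alpha u).
have S0 : 0 <= S by rewrite fine_ge0 // holder_seminorm_ge0.
pose e := (`|u y| - M) / (S + 1).
have e0 : 0 < e by rewrite divr_gt0 ?subr_gt0 // ltr_wpDl.
(* On the ball of squared radius [b] the Holder bound is at most [S * e]. *)
pose b := e `^ (2 / alpha).
have b0 : 0 < b by rewrite powR_gt0.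
have big x : sqball y b x -> M < `|u x|.
  move=> xb; have := holder_le x y; rewrite -/S => h.
  have qe : sqdist y x `^ (alpha / 2) <= e.
    have -> : e = b `^ (alpha / 2).
      rewrite /b -powRrM mulrA divfK ?gt_eqF // divff ?powRr1 //; exact: ltW.
    by apply: ge0_ler_powR; rewrite ?nnegrE ?divr_ge0 ?sqdist_ge0 // ltW.
  have he : S * sqdist y x `^ (alpha / 2) <= S * e by exact: ler_wpM2l.
  have eE : e * (S + 1) = `|u y| - M by rewrite divfK // gt_eqF // ltr_wpDl.
  have h2 : `|u y| <= `|u x| + `|u x - u y|.
    by rewrite distrC -[in leLHS](subrKC (u x) (u y)) ler_normD.
  by lra.
have [N [mN N0 uN]] : (leb4 R).-negligible [set x | ~ (`|u x| <= M)].
  have : \forall x \ae leb4 R, ((abse \o (EFin \o u)) x <= M%:E)%E.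
    apply/ess_supP; rewrite -LinftyE /M fineK //; exact: holder_Linfty_fin.
  by apply: negligibleS => x /= h1 h2; apply: h1; rewrite -lee_fin.
have : (leb4 R (sqball y b) <= leb4 R N)%E.
  apply: le_measure; rewrite ?inE //; first exact: measurable_sqball.
  by move=> x /big h; apply: uN => /=; rewrite leNgt h.
rewrite N0 leb4_sqball // leNgt lte_fin mulr_gt0 ?exprn_gt0 ?pi_gt0 //.
by rewrite divr_gt0 // exprn_gt0.
Qed.

End holder_facts.

End Holder.

Section WeakLaplacian.
Context {R : realType}.
Implicit Types (u f g phi : R4 R -> R) (i : 'I_4).

Lemma weakD_spec u s : H2 u -> (size s <= 2)%N -> is_weakD s u (weakD s u).
Proof. by move=> [_ h] /h [g gP]; exact: (xgetPex (fun=> 0) (ex_intro _ g gP)). Qed.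

Lemma in_L2_laplacian u : H2 u -> in_L2 (laplacian u).
Proof.
move=> hu; rewrite (_ : laplacian u = fun x => weakD [:: 0; 0] u x +
    weakD [:: 1; 1] u x + weakD [:: 2; 2] u x + weakD [:: 3; 3] u x); last first.
  by apply/funext => x; rewrite /laplacian big_ord4.
have l2 i : in_L2 (weakD [:: i; i] u) by case: (@weakD_spec u [:: i; i] hu isT).
by do 3![apply: in_L2D => //].
Qed.

Lemma ball_support_compact phi y b : (forall x, b <= sqdist y x -> phi x = 0) ->
  compact (closure [set x | phi x != 0]).
Proof.
move=> phi0.
apply: (@subclosed_compact _ _ (closure [set x | sqdist y x < b])).
- exact: closed_closure.
- exact: compact_sqdist_le.
apply: closure_subset => x /=; rewrite ltNge; apply: contra => /phi0 ->.
by rewrite eqxx.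
Qed.

Lemma continuous_ball_bounded f y b : continuous f ->
  (forall x, b <= sqdist y x -> f x = 0) ->
  exists2 M, 0 <= M & forall x, `|f x| <= M.
Proof.
move=> cf f0.
have cK : compact (f @` closure [set x | sqdist y x < b]).
  apply: continuous_compact; last exact: compact_sqdist_le.
  exact: continuous_subspaceT.
have [M [_ HM]] := compact_bounded cK.
exists (Num.max M 0 + 1); first by rewrite addr_ge0 // le_max lexx orbT.
move=> x; have [bx|xb] := leP b (sqdist y x).
  by rewrite f0 // normr0 addr_ge0 // le_max lexx orbT.
apply: (HM (Num.max M 0 + 1)).
  by rewrite (@le_lt_trans _ _ (Num.max M 0)) ?le_max ?lexx // ltrDl.
by exists x => //; exact: subset_closure.
Qed.

Lemma smooth_ball_L2 f y b : 0 < b -> smooth f ->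
  (forall x, b <= sqdist y x -> f x = 0) ->
  exists2 B, 0 <= B & (\int[leb4 R]_x (f x ^+ 2)%:E <= (B ^+ 2)%:E)%E.
Proof.
move=> b0 sf f0.
have [M M0 fM] := continuous_ball_bounded (smooth_continuous sf) f0.
exact: bounded_ball_L2 (smooth_measurable sf) b0 M0 f0 fM.
Qed.

Lemma integrable_L2_smooth g f y b : 0 < b -> in_L2 g -> smooth f ->
  (forall x, b <= sqdist y x -> f x = 0) ->
  (leb4 R).-integrable setT (EFin \o (fun x => g x * f x)).
Proof.
move=> b0 g2 sf f0; have [B B0 fB] := smooth_ball_L2 b0 sf f0.
apply: (integrable_mul_L2 g2.1 (smooth_measurable sf) (nrm2_ge0 g) B0) => //.
by rewrite in_L2_integral.
Qed.

(** Green's identity: the four weak second derivatives are tested one at a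
    time, so each product has to be integrable on its own. *)
Lemma weak_laplacian u phi y b : H2 u -> 0 < b ->
  smooth phi -> (forall x, b <= sqdist y x -> phi x = 0) ->
  (forall i x, b <= sqdist y x -> partials [:: i; i] phi x = 0) ->
  \int[leb4 R]_x (u x * \sum_(i < 4) partials [:: i; i] phi x) =
  \int[leb4 R]_x (laplacian u x * phi x).
Proof.
move=> hu b0 sphi phi0 dphi0.
have tphi : test_function phi.
  by apply: smooth_test_function => //; exact: ball_support_compact phi0.
pose D i := partials [:: i; i] phi.
have sD i : smooth (D i) by exact: smooth_partials.
have iu i := integrable_L2_smooth b0 hu.1 (sD i) (dphi0 i).
have wD i := @weakD_spec u [:: i; i] hu isT.
have ig i := integrable_L2_smooth b0 (wD i).1 sphi phi0.
have E i : \int[leb4 R]_x (u x * D i x) =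
    \int[leb4 R]_x (weakD [:: i; i] u x * phi x).
  by rewrite (wD i).2 //= sqrrN expr1n mul1r.
have split4 (F : 'I_4 -> R4 R -> R) :
    (forall i, (leb4 R).-integrable setT (EFin \o F i)) ->
    \int[leb4 R]_x (\sum_(i < 4) F i x) = \sum_(i < 4) \int[leb4 R]_x F i x.
  move=> iF; rewrite big_ord4; under eq_Rintegral do rewrite big_ord4.
  have i2 := integrableD measurableT (iF 0) (iF 1).
  have i3 := integrableD measurableT i2 (iF 2).
  rewrite (RintegralD measurableT i3 (iF 3)).
  by rewrite (RintegralD measurableT i2 (iF 2)) (RintegralD measurableT (iF 0) (iF 1)).
transitivity (\sum_(i < 4) \int[leb4 R]_x (u x * D i x)).
  rewrite -(split4 (fun i x => u x * D i x)) //.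
  by apply: eq_Rintegral => x _; rewrite mulr_sumr.
under eq_bigr do rewrite E.
rewrite -(split4 (fun i x => weakD [:: i; i] u x * phi x)) //.
by apply: eq_Rintegral => x _; rewrite /laplacian mulr_suml.
Qed.

End WeakLaplacian.

(** * The pointwise estimate *)

Section PointwiseBound.
Context {R : realType}.
Variables (alpha a b : R) (u : R4 R -> R).
Hypotheses (alpha0 : 0 < alpha) (alpha1 : alpha < 1).
Hypotheses (a0 : 0 < a) (ab : a <= b) (b1 : 1 <= b).
Hypotheses (hu : H2 u) (hol : holder alpha u).
Implicit Types (x y : R4 R).

Let s := alpha / 2.
Let H := fine (holder_norm alpha u).
Let b0 : 0 < b. Proof. exact: lt_le_trans b1. Qed.
Let s0 : 0 < s. Proof. by rewrite /s divr_gt0. Qed.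
Let s2 : s < 2^-1. Proof. by rewrite /s ltr_pdivrMr // mulVf // pnatr_eq0. Qed.

Let M0 : 0 <= fine (LpNorm +oo u). Proof. by rewrite fine_ge0 // Lnorm_ge0. Qed.

Let S0 : 0 <= fine (holder_seminorm alpha u).
Proof. by rewrite fine_ge0 // holder_seminorm_ge0. Qed.

Let HE : H = fine (LpNorm +oo u) + fine (holder_seminorm alpha u).
Proof. exact: fine_holder_norm. Qed.

Let le_H y : `|u y| <= H.
Proof. by rewrite HE (le_trans (le_Linfty alpha0 hol y)) // lerDl. Qed.

Let phi y : R4 R -> R := profile a b \o sqdist y.

Let inv y x : R := (sqdist y x + a)^-1.

Let smooth_inv y : smooth (inv y).
Proof.
have sa : smooth (fun x => sqdist y x + a).
  exact: smoothD (smooth_sqdist y) (smooth_cst a).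
by apply: (smoothV sa) => x; rewrite ltr_wpDl // sqdist_ge0.
Qed.

Let smooth_phi y : smooth (phi y).
Proof.
have sq := smooth_sqdist y.
have sqb : smooth (fun x => sqdist y x * b^-1).
  exact: smoothM sq (smooth_cst b^-1).
have sT : smooth (fun x => 1 - (sqdist y x / b) ^+ 2).
  exact: smoothB (smooth_cst 1) (smoothM sqb sqb).
have sc : smooth (fun x => expR 1 * flat 0 (1 - (sqdist y x / b) ^+ 2)).
  exact: smoothM (smooth_cst (expR 1)) (smooth_flat 0 sT).
exact: smoothM sc (smooth_inv y).
Qed.

Let phi_eq0 y x : b <= sqdist y x -> phi y x = 0.
Proof. by move=> h; rewrite /phi /= profile_eq0. Qed.

Let partial2_phi_eq0 y i x : b <= sqdist y x -> partials [:: i; i] (phi y) x = 0.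
Proof.
move=> h; rewrite (partial2_radial y (@is_derive_profile R a b a0 b0)
  (@is_derive_profile1 R a b a0 b0)).
by rewrite profile1_eq0 // profile2_eq0 // !mulr0 addr0.
Qed.

Let lap y x := \sum_(i < 4) partials [:: i; i] (phi y) x.

Let lapE y x :
  lap y x = 4 * sqdist y x * profile2 a b (sqdist y x)
    + 8 * profile1 a b (sqdist y x).
Proof.
exact: laplacian_radial (@is_derive_profile R a b a0 b0)
  (@is_derive_profile1 R a b a0 b0) x.
Qed.

Let integrable_u_lap y :
  (leb4 R).-integrable setT (EFin \o (fun x => u x * lap y x)).
Proof.
apply: (integrable_L2_smooth (y := y) b0 hu.1) => [|x h].
  rewrite (_ : lap y = fun x => partials [:: 0; 0] (phi y) x
    + partials [:: 1; 1] (phi y) x + partials [:: 2; 2] (phi y) x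
    + partials [:: 3; 3] (phi y) x); last first.
    by apply/funext => x; rewrite /lap big_ord4.
  do 3![apply: smoothD; last exact: smooth_partials (smooth_phi y)].
  exact: smooth_partials (smooth_phi y).
rewrite /lap; apply: big1 => i _.
exact: partial2_phi_eq0.
Qed.

(** The pairing with the Laplacian of [u], by Cauchy-Schwarz: the profile is
    at most [(t + a) ^-1], whose square has a logarithmic integral. *)
Let pairing_le y :
  `|\int[leb4 R]_x (laplacian u x * phi y x)|
  <= nrm2 (laplacian u) * (pi * Num.sqrt (ln (1 + b / a))).
Proof.
have w2 := in_L2_laplacian hu.
have ba0 : 0 < b / a by exact: divr_gt0.
apply: (Rintegral_mul_L2_le w2.1 (smooth_measurable (smooth_phi y))).
- exact: nrm2_ge0.
- by rewrite mulr_ge0 ?pi_ge0.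
- by rewrite in_L2_integral.
rewrite exprMn sqr_sqrtr; last by rewrite ln_ge0 // lerDl ltW.
apply: le_trans (integral_log_kernel y a0 b0).
apply: ge0_le_integral => //.
- by move=> x _; rewrite lee_fin sqr_ge0.
- by apply/measurable_EFinP; apply: measurable_funX;
    exact: smooth_measurable (smooth_phi y).
- apply/measurable_EFinP; apply: measurable_funM.
    by apply: measurable_indic; exact: measurable_sqball.
  by apply: measurable_funX; exact: smooth_measurable (smooth_inv y).
move=> x _; rewrite lee_fin indicE.
have [xb|xb] := boolP (x \in sqball y b); last first.
  rewrite mul0r phi_eq0 ?expr0n // leNgt.
  by move: xb; rewrite notin_setE => /negP.
have qa : 0 < sqdist y x + a by rewrite ltr_wpDl // sqdist_ge0.
rewrite mul1r lerXn2r ?nnegrE ?invr_ge0 ?(ltW qa) //.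
  by rewrite /phi /= /profile mulr_ge0 ?cutoff_ge0 // invr_ge0 ltW.
by rewrite /phi /= /profile ger_pMl ?invr_gt0 // cutoff_le1.
Qed.

Let kernel y x : R := \1_(sqball y b) x * (8 * a * inv y x ^+ 3).

Let measurable_kernel y : measurable_fun setT (kernel y : Leb4 R -> R).
Proof.
apply: measurable_funM.
  by apply: measurable_indic; exact: measurable_sqball.
apply: measurable_funM; first exact: measurable_cst.
by apply: measurable_funX; exact: smooth_measurable (smooth_inv y).
Qed.

Let inv_gt0 y x : 0 < inv y x.
Proof. by rewrite invr_gt0 ltr_wpDl // sqdist_ge0. Qed.

Let kernel_ge0 y x : 0 <= kernel y x.
Proof.
by rewrite mulr_ge0 ?indicE // !mulr_ge0 ?exprn_ge0 ?(ltW (inv_gt0 _ _)) // ltW.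
Qed.

Let mass : R := 4 * pi ^+ 2 * (b / (b + a)) ^+ 2.

Let integrable_kernel y : (leb4 R).-integrable setT (EFin \o kernel y).
Proof.
apply/integrableP; split; first by apply/measurable_EFinP; exact: measurable_kernel.
under eq_integral do rewrite /= ger0_norm //.
by rewrite (integral_kernel y a0 b0) ltry.
Qed.

Let Rintegral_kernel y : \int[leb4 R]_x kernel y x = mass.
Proof. by rewrite /Rintegral (integral_kernel y a0 b0). Qed.

(** The oscillation of the truncated field on the ball: Holder continuity
    handles the field, flatness at the origin handles the cutoff. *)
Let oscillation_le y x : sqdist y x < b ->
  `|u y - cutoff b (sqdist y x) * u x| <= 2 * H * (sqdist y x + a) `^ s.
Proof.
move=> qb; set q := sqdist y x; set chi := cutoff b q.
have q0 : 0 <= q := sqdist_ge0 y x.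
have P0 : 0 <= q `^ s := powR_ge0 _ _.
have chi0 : 0 <= chi := cutoff_ge0 b q.
have chi1 : chi <= 1 := cutoff_le1 b q.
have h1 : `|u y - u x| <= fine (holder_seminorm alpha u) * q `^ s.
  by rewrite distrC; exact: holder_le.
have h2 : 1 - chi <= 2 * q `^ s.
  apply: le_trans (cutoff_ge b q) _; rewrite ler_wpM2l //.
  have t0 : 0 <= q / b by rewrite divr_ge0 // ltW.
  have t1 : q / b <= 1 by rewrite ler_pdivrMr // mul1r ltW.
  apply: (@le_trans _ _ ((q / b) `^ s)); last first.
    apply: ge0_ler_powR; rewrite ?nnegrE ?(ltW s0) //.
    by rewrite ler_pdivrMr // ler_peMr.
  have [->|tn0] := eqVneq (q / b) 0; first by rewrite expr0n powR_ge0.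
  rewrite -powR_mulrn //; apply: ger_powR.
    by rewrite lt_neqAle eq_sym tn0 t0.
  by have := s2; lra.
have h3 : q `^ s <= (q + a) `^ s.
  by apply: ge0_ler_powR; rewrite ?nnegrE ?(ltW s0) ?addr_ge0 ?lerDl ?(ltW a0).
have -> : u y - chi * u x = chi * (u y - u x) + (1 - chi) * u y by ring.
apply: le_trans (ler_normD _ _) _.
rewrite (normrM chi) (normrM (1 - chi)) (ger0_norm chi0).
rewrite [X in _ + X * _]ger0_norm ?subr_ge0 //.
have h4 : chi * `|u y - u x| <= fine (holder_seminorm alpha u) * q `^ s.
  by apply: le_trans h1; rewrite ler_piMl.
have h5 : (1 - chi) * `|u y| <= 2 * q `^ s * fine (LpNorm +oo u).
  by apply: ler_pM; rewrite ?subr_ge0 ?(le_Linfty alpha0 hol).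
apply: (@le_trans _ _ (2 * H * q `^ s)); last first.
  by rewrite ler_wpM2l // mulr_ge0 // HE addr_ge0.
have h6 := mulr_ge0 S0 P0.
by apply: le_trans (lerD h4 h5) _; rewrite HE; lra.
Qed.

Let E : R := cutoff_cst / b ^+ 2.

Let E_ge0 : 0 <= E.
Proof. by apply: divr_ge0; [exact: cutoff_cst_ge0|exact: sqr_ge0]. Qed.

(** What is left of the kernel representation once the Laplacian of the test
    function has been paired with [u]. *)
Let remainder y x : R := u y * kernel y x + u x * lap y x.

Let remainder_le y x : `|remainder y x| <=
  2 * H * (\1_(sqball y b) x * (8 * a * inv y x ^+ 3 * (sqdist y x + a) `^ s))
  + E * `|u x * \1_(sqball y b) x|.
Proof.
rewrite /remainder /kernel !indicE.
have [xb|xb] := boolP (x \in sqball y b); last first.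
  have bq : b <= sqdist y x.
    by rewrite leNgt; move: xb; rewrite notin_setE => /negP.
  rewrite lapE profile1_eq0 // profile2_eq0 //.
  by rewrite !(mulr0, mul0r, addr0, normr0).
have qb : sqdist y x < b by move: xb; rewrite inE.
rewrite !mul1r mulr1.
(* The singular part of the Laplacian is split off: it turns [u y] into an
   oscillation, and the rest is bounded by [E]. *)
have -> : u y * (8 * a * inv y x ^+ 3) + u x * lap y x =
    8 * a * inv y x ^+ 3 * (u y - cutoff b (sqdist y x) * u x) +
    u x * (lap y x + 8 * a * cutoff b (sqdist y x) * inv y x ^+ 3) by ring.
have k0 : 0 <= 8 * a * inv y x ^+ 3.
  by rewrite !mulr_ge0 ?exprn_ge0 ?(ltW (inv_gt0 _ _)) // ltW.
apply: le_trans (ler_normD _ _) _.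
rewrite (normrM (8 * a * inv y x ^+ 3)) (ger0_norm k0) (normrM (u x)).
apply: lerD.
  by rewrite [leRHS]mulrCA; apply: ler_wpM2l => //; exact: oscillation_le.
rewrite mulrC ler_wpM2r // lapE.
have := laplacian_profile_bound a0 b0 (sqdist_ge0 y x).
by rewrite qb.
Qed.

Let integrable_ykernel y :
  (leb4 R).-integrable setT (EFin \o (fun x => u y * kernel y x)).
Proof.
have := integrableZl measurableT (u y) (integrable_kernel y).
by apply: eq_integrable.
Qed.

Let integrable_remainder y :
  (leb4 R).-integrable setT (EFin \o remainder y).
Proof.
have := integrableD measurableT (integrable_ykernel y) (integrable_u_lap y).
by apply: eq_integrable.
Qed.

Let remainder_integral_le y : `|\int[leb4 R]_x remainder y x| <=
  2 * H * (16 * pi ^+ 2 * a `^ s) +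
  E * (nrm2 u * (pi * Num.sqrt (b ^+ 2 / 2))).
Proof.
have H0 : 0 <= H by rewrite HE addr_ge0.
have mi : measurable_fun setT (\1_(sqball y b) : Leb4 R -> R).
  by apply: measurable_indic; exact: measurable_sqball.
have mfu : measurable_fun setT (u : Leb4 R -> R) := hu.1.1.
pose K x : R := \1_(sqball y b) x *
  (8 * a * inv y x ^+ 3 * (sqdist y x + a) `^ s).
have mK : measurable_fun setT (K : Leb4 R -> R).
  apply: measurable_funM => //; apply: measurable_funM.
    apply: measurable_funM; first exact: measurable_cst.
    by apply: measurable_funX; exact: smooth_measurable (smooth_inv y).
  apply: (measurableT_comp (measurable_powR s)).
  by apply: measurable_funD; [exact: measurable_sqdist|exact: measurable_cst].
have K0 x : 0 <= K x.
  rewrite mulr_ge0 ?indicE // mulr_ge0 ?powR_ge0 //.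
  by rewrite !mulr_ge0 ?exprn_ge0 ?(ltW (inv_gt0 _ _)) // ltW.
apply: le_trans (le_normr_Rintegral measurableT (integrable_remainder y)) _.
pose bound x := ((2 * H)%:E * (K x)%:E +
  E%:E * `|u x * \1_(sqball y b) x|%:E)%E.
have main : (\int[leb4 R]_x `|remainder y x|%:E <= (2 * H *
    (16 * pi ^+ 2 * a `^ s) + E * (nrm2 u * (pi * Num.sqrt (b ^+ 2 / 2))))%:E)%E.
  apply: (@le_trans _ _ (\int[leb4 R]_x bound x)%E).
    apply: ge0_le_integral => //.
    - apply/measurable_EFinP; apply: measurableT_comp => //.
      have [mR _] := integrableP _ _ _ (integrable_remainder y).
      exact/measurable_EFinP.
    - apply: emeasurable_funD; apply: measurable_funeM; apply/measurable_EFinP => //.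
      by apply: measurableT_comp => //; exact: measurable_funM.
    - move=> x _; rewrite /bound -!EFinM -EFinD lee_fin; exact: remainder_le.
  have mm : measurable_fun setT (fun x : Leb4 R => `|u x * \1_(sqball y b) x|%:E).
    by apply/measurable_EFinP; apply: measurableT_comp => //;
      exact: measurable_funM.
  have HH0 : 0 <= 2 * H by rewrite mulr_ge0.
  rewrite ge0_integralD //; last 4 first.
  - by move=> x _; rewrite mule_ge0 ?lee_fin.
  - by apply: measurable_funeM; apply/measurable_EFinP.
  - by move=> x _; rewrite mule_ge0 ?lee_fin.
  - exact: measurable_funeM.
  rewrite ge0_integralZl //; last 2 first.
  - exact/measurable_EFinP.
  - by move=> x _; rewrite lee_fin.
  rewrite ge0_integralZl //.
  rewrite EFinD !(EFinM _ (_ * _)).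
  apply: leeD; apply: lee_wpmul2l; rewrite ?lee_fin //.
    by apply: integral_kernel_powR => //; rewrite s0.
  apply: cauchy_schwarz => //.
  - exact: nrm2_ge0.
  - by rewrite mulr_ge0 ?pi_ge0.
  - by rewrite in_L2_integral //; exact: hu.1.
  - by rewrite ball_indic_L2.
rewrite -lee_fin /Rintegral fineK //.
rewrite ge0_fin_numE; last by apply: integral_ge0 => x _; rewrite lee_fin.
exact: le_lt_trans main (ltry _).
Qed.

(** The mass defect [1 - r ^ 2] is also of order [a ^ s], because
    [a / (b + a) <= a / b <= (a / b) ^ s] and [b >= 1]. *)
Lemma pointwise_bound y :
  `|u y| <= nrm2 (laplacian u) / (4 * pi) * Num.sqrt (ln (1 + b / a)) +
     (cutoff_cst + 10) * (nrm2 u / b + H * a `^ s).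
Proof.
have H0 : 0 <= H by rewrite HE addr_ge0.
have A0 : 0 <= a `^ s := powR_ge0 _ _.
have N0 := nrm2_ge0 u.
have pi1 : 1 <= pi :> R by rewrite (le_trans _ (pi_ge2 _)) // ler1n.
have p0 : 0 < pi :> R := pi_gt0 R.
have mass_eq : u y * mass = \int[leb4 R]_x remainder y x
    - \int[leb4 R]_x (laplacian u x * phi y x).
  rewrite -(weak_laplacian hu b0 (smooth_phi y) (@phi_eq0 y)
    (@partial2_phi_eq0 y)).
  rewrite (RintegralD measurableT (integrable_ykernel y) (integrable_u_lap y)).
  rewrite addrK (RintegralZl _ measurableT (integrable_kernel y)).
  by rewrite Rintegral_kernel.
have ba0 : 0 < b + a by rewrite addr_gt0.
set r := b / (b + a); have mE : mass = 4 * pi ^+ 2 * r ^+ 2 by [].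
have r0 : 0 <= r by rewrite divr_ge0 ?ltW.
have r1 : r <= 1 by rewrite ler_pdivrMr // mul1r lerDl ltW.
have rA : 1 - r <= a `^ s.
  have -> : 1 - r = a / (b + a) by rewrite /r; field; rewrite gt_eqF.
  have t0 : 0 < a / b by exact: divr_gt0.
  have t1 : a / b <= 1 by rewrite ler_pdivrMr // mul1r.
  apply: (@le_trans _ _ (a / b)).
    by rewrite ler_wpM2l ?(ltW a0) // lef_pV2 ?posrE // lerDl ltW.
  apply: (@le_trans _ _ ((a / b) `^ s)).
    rewrite -[leLHS]powRr1 ?(ltW t0) //; apply: ger_powR; first by rewrite t0.
    by have := s2; lra.
  apply: ge0_ler_powR; rewrite ?nnegrE ?(ltW s0) ?(ltW t0) ?(ltW a0) //.
  by rewrite ler_pdivrMr // ler_peMr // ltW.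
set L := Num.sqrt (ln (1 + b / a)).
have step : `|u y| * mass <= 2 * H * (16 * pi ^+ 2 * a `^ s)
    + E * (nrm2 u * (pi * Num.sqrt (b ^+ 2 / 2)))
    + nrm2 (laplacian u) * (pi * L).
  have m0 : 0 <= mass.
    by rewrite mE; apply: mulr_ge0; [apply: mulr_ge0|]; rewrite ?sqr_ge0.
  rewrite -(ger0_norm m0) -normrM mass_eq.
  apply: le_trans (ler_normB _ _) _.
  exact: lerD (remainder_integral_le y) (pairing_le y).
have sb : Num.sqrt (b ^+ 2 / 2) <= b.
  rewrite -[leRHS](gtr0_norm b0) -sqrtr_sqr ler_wsqrtr //.
  by rewrite ler_pdivrMr // ler_peMr ?sqr_ge0 // ler1n.
have EN : E * (nrm2 u * (pi * Num.sqrt (b ^+ 2 / 2))) <=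
    cutoff_cst * pi * (nrm2 u / b).
  have -> : cutoff_cst * pi * (nrm2 u / b) = E * (nrm2 u * (pi * b)).
    by rewrite /E; field; rewrite gt_eqF.
  apply: ler_wpM2l => //; apply: ler_wpM2l => //; apply: ler_wpM2l => //.
  exact: ltW.
have pp : 0 < 4 * pi ^+ 2 :> R by rewrite mulr_gt0 ?exprn_gt0.
have H1 : `|u y| * (4 * pi ^+ 2 * (1 - r ^+ 2)) <= H * (8 * pi ^+ 2 * a `^ s).
  apply: ler_pM => //.
    by apply: mulr_ge0; rewrite ?(ltW pp) // subr_ge0 expr_le1.
  rewrite (_ : 8 * pi ^+ 2 * a `^ s = 4 * pi ^+ 2 * (2 * a `^ s)); last by ring.
  by apply: ler_wpM2l; [exact: ltW|nra].
have sum : `|u y| * (4 * pi ^+ 2) <= nrm2 (laplacian u) * (pi * L) +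
    cutoff_cst * pi * (nrm2 u / b) + 40 * pi ^+ 2 * (H * a `^ s).
  move: step; rewrite mE => step; lra.
rewrite -(ler_pM2r pp); apply: le_trans sum _.
have cancel_pi (p W l : R) : p != 0 ->
    W * (p * l) = W / (4 * p) * l * (4 * p ^+ 2).
  by move=> p_neq0; field.
rewrite [leRHS]mulrDl -[leLHS]addrA; apply: lerD.
  by rewrite -cancel_pi // gt_eqF.
have e0 : 0 <= cutoff_cst :> R := cutoff_cst_ge0.
have X0 : 0 <= nrm2 u / b by rewrite divr_ge0 // ltW.
have Y0 : 0 <= H * a `^ s by exact: mulr_ge0.
have X1 : cutoff_cst * pi * (nrm2 u / b) <=
    cutoff_cst * (nrm2 u / b) * (4 * pi ^+ 2).
  rewrite [leLHS]mulrAC; apply: ler_wpM2l; first exact: mulr_ge0.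
  by nra.
have X2 : 0 <= 10 * (nrm2 u / b) * (4 * pi ^+ 2).
  by apply: mulr_ge0 (ltW pp); exact: mulr_ge0.
have X3 : 0 <= cutoff_cst * (H * a `^ s) * (4 * pi ^+ 2).
  by apply: mulr_ge0 (ltW pp); exact: mulr_ge0.
lra.
Qed.

End PointwiseBound.

(** * Choice of the radius and conclusion *)

Section Optimisation.
Context {R : realType}.
Implicit Types (a b e s : R).

(** Young's inequality with a free parameter: the loss in front of the
    logarithm can be made as small as desired. *)
Lemma sqrD_le_weighted (x c t : R) : 0 < t ->
  (x + c) ^+ 2 <= (1 + t) * x ^+ 2 + (1 + t^-1) * c ^+ 2.
Proof.
move=> t0; rewrite -subr_ge0.
have -> : (1 + t) * x ^+ 2 + (1 + t^-1) * c ^+ 2 - (x + c) ^+ 2 =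
    (t * x - c) ^+ 2 / t by field; rewrite gt_eqF.
by rewrite divr_ge0 ?sqr_ge0 // ltW.
Qed.

Lemma log_absorb (l1 l c z : R) : 0 <= z -> 0 < l1 -> l1 < l -> 0 <= c ->
  l1 * ln (1 + z) + c <= l * ln (expR (c / (l - l1)) + z).
Proof.
move=> z0 l10 l1l c0; set k := c / (l - l1).
have d0 : 0 < l - l1 by rewrite subr_gt0.
have k0 : 0 <= k by rewrite divr_ge0 // ltW.
have E1 : 1 <= expR k by rewrite -expR0 ler_expR.
have h1 : ln (1 + z) <= ln (expR k + z).
  by rewrite ler_ln ?posrE ?lerD2r // ltr_pwDl // ?expR_gt0.
have h2 : k <= ln (expR k + z).
  rewrite -[leLHS]expRK ler_ln ?posrE ?expR_gt0 ?lerDl //.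
  by rewrite ltr_pwDl // expR_gt0.
have -> : c = (l - l1) * k by rewrite /k mulrC divfK // gt_eqF.
have -> : l * ln (expR k + z) =
    l1 * ln (expR k + z) + (l - l1) * ln (expR k + z) by ring.
by apply: lerD; apply: ler_wpM2l => //; exact: ltW.
Qed.

(** The radius is the one at which the Holder error equals [e], unless that
    radius exceeds the truncation scale [b]. *)
Lemma exists_radius b e s : 0 < b -> 0 < e -> 0 < s ->
  exists a, [/\ 0 < a, a <= b, a `^ s <= e &
    b / a <= Num.max 1 (b * (e^-1) `^ s^-1)].
Proof.
move=> b0 e0 s0; pose r := e `^ s^-1.
have r0 : 0 < r by exact: powR_gt0.
exists (Num.min b r); split.
- by rewrite lt_min b0.
- by rewrite ge_min lexx.
- have -> : e = r `^ s by rewrite /r -powRrM mulVf ?gt_eqF // powRr1 // ltW.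
  apply: ge0_ler_powR; rewrite ?nnegrE ?(ltW s0) ?(ltW r0) ?ge_min ?lexx ?orbT //.
  by rewrite le_min !ltW.
have rV : (e^-1) `^ s^-1 = r^-1.
  by rewrite -[e^-1]powR_inv1 ?ltW // -powRrM mulN1r powRN.
rewrite rV le_max; have [br|rb] := leP b r.
  by rewrite divff ?gt_eqF // lexx.
by rewrite lexx orbT.
Qed.

End Optimisation.

Section Conclusion.
Context {R : realType}.
Variables (alpha mu : R) (u : R4 R -> R).
Hypotheses (alpha0 : 0 < alpha) (alpha1 : alpha < 1).
Hypotheses (mu0 : 0 < mu) (mu1 : mu <= 1).
Hypotheses (hu : H2 u) (hol : holder alpha u) (u_neq0 : u <> (fun=> 0)).

Let N := munorm mu u.
Let H := fine (holder_norm alpha u).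
Let K : R := cutoff_cst + 10.
Let b : R := (Num.sqrt mu)^-1.

Let sqrt_mu_gt0 : 0 < Num.sqrt mu. Proof. by rewrite sqrtr_gt0. Qed.

Let b1 : 1 <= b.
Proof.
by rewrite /b invf_ge1 // -sqrtr1 ler_wsqrtr.
Qed.

Let b0 : 0 < b. Proof. exact: lt_le_trans b1. Qed.

Let N_ge0 : 0 <= N. Proof. exact: sqrtr_ge0. Qed.

Let NE : N ^+ 2 = (1 + 3 * mu) * nrm2 (laplacian u) ^+ 2 +
  3 * mu * (nrm2 u ^+ 2 + fine (LpNorm 2%:E (grad_norm u)) ^+ 2).
Proof.
rewrite sqr_sqrtr // /munorm_sq /H1norm_sq.
have m0 := ltW mu0.
by apply: addr_ge0; apply: mulr_ge0; rewrite ?sqr_ge0 ?addr_ge0 ?sqr_ge0 ?mulr_ge0.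
Qed.

Let laplacian_le : nrm2 (laplacian u) <= N.
Proof.
have n0 := nrm2_ge0 (laplacian u).
rewrite -(ler_pXn2r (ltn0Sn 1)) ?nnegrE // NE.
have h1 := sqr_ge0 (nrm2 (laplacian u)).
have h2 := mulr_ge0 (ltW mu0) h1.
have h3 := mulr_ge0 (ltW mu0) (sqr_ge0 (nrm2 u)).
have h4 := mulr_ge0 (ltW mu0) (sqr_ge0 (fine (LpNorm 2%:E (grad_norm u)))).
lra.
Qed.

Let nrm2_le : nrm2 u / b <= N.
Proof.
have n0 := nrm2_ge0 u.
have s0 := ltW sqrt_mu_gt0.
rewrite /b invrK -(ler_pXn2r (ltn0Sn 1)) ?nnegrE ?mulr_ge0 //.
rewrite exprMn sqr_sqrtr ?(ltW mu0) // NE.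
have h1 := sqr_ge0 (nrm2 (laplacian u)).
have h2 := mulr_ge0 (ltW mu0) h1.
have h3 := mulr_ge0 (ltW mu0) (sqr_ge0 (nrm2 u)).
have h4 := mulr_ge0 (ltW mu0) (sqr_ge0 (fine (LpNorm 2%:E (grad_norm u)))).
lra.
Qed.

Let K_gt0 : 0 < K.
Proof. by rewrite /K ltr_wpDl // cutoff_cst_ge0. Qed.

Let bound (a : R) y : 0 < a -> a <= b -> `|u y| <=
  N / (4 * pi) * Num.sqrt (ln (1 + b / a)) + K * (N + H * a `^ (alpha / 2)).
Proof.
move=> a0 ab.
apply: le_trans (pointwise_bound alpha0 alpha1 a0 ab b1 hu hol y) _.
apply: lerD.
  rewrite ler_wpM2r // ler_wpM2r // invr_ge0 mulr_ge0 // pi_ge0 //.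
by rewrite ler_wpM2l ?(ltW K_gt0) // lerD2r.
Qed.

Let exists_neq0 : exists y, u y != 0.
Proof.
apply/not_existsP => h; apply: u_neq0; apply/funext => y.
by have /negP := h y; rewrite negbK => /eqP.
Qed.

Let H_gt0 : 0 < H.
Proof.
have [y uy] := exists_neq0.
rewrite /H fine_holder_norm // ltr_pwDl ?fine_ge0 ?holder_seminorm_ge0 //.
by apply: lt_le_trans (le_Linfty alpha0 hol y); rewrite normr_gt0.
Qed.

(** Were the norm zero, letting [a] tend to 0 in the pointwise estimate would
    make [u] vanish. *)
Let N_gt0 : 0 < N.
Proof.
rewrite lt_neqAle N_ge0 andbT eq_sym; apply/eqP => N0.
have [y uy] := exists_neq0.
have uy0 : 0 < `|u y| by rewrite normr_gt0.
pose e := `|u y| / (2 * K * H).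
have KH : 0 < K * H by exact: mulr_gt0.
have e0 : 0 < e by rewrite divr_gt0 // -mulrA mulr_gt0.
have [a [a0 ab ae _]] := exists_radius b0 e0 (divr_gt0 alpha0 (ltr0n _ 2)).
have := bound y a0 ab; rewrite N0 !mul0r !add0r.
have -> : `|u y| = 2 * (K * H * e).
  by rewrite /e; field; rewrite !gt_eqF.
have := ler_wpM2l (ltW KH) ae; have := mulr_gt0 KH e0; rewrite -!mulrA.
lra.
Qed.

Let Z := 8 `^ alpha * mu `^ (- alpha) * H / N.

Let Z_ge0 : 0 <= Z.
Proof. by rewrite divr_ge0 // mulr_ge0 ?(ltW H_gt0) // mulr_ge0 ?powR_ge0. Qed.

(** The powers of [mu] and of 8 in [Z] leave room: [b = mu ^ (- 1 / 2)] only
    requires [mu ^ (- alpha / 4)]. *)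
Let log_le (a : R) : b / a <= Num.max 1 (b * (H / N) `^ (alpha / 2)^-1) -> 0 < a ->
  ln (1 + b / a) <= ln 2 + 2 / alpha * ln (1 + Z).
Proof.
move=> ba a0.
have Z1 : 1 <= 1 + Z by rewrite lerDl.
have Z10 : 0 < 1 + Z by rewrite ltr_pwDl.
set p := 2 / alpha; have p0 : 0 < p by exact: divr_gt0.
have pE : (alpha / 2)^-1 = p by rewrite invf_div.
have P1 : 1 <= (1 + Z) `^ p.
  have : 1 `^ p <= (1 + Z) `^ p.
    by apply: ge0_ler_powR; rewrite ?nnegrE ?(ltW p0) ?(ltW Z10).
  by rewrite powR1.
have HN0 : 0 <= H / N by rewrite divr_ge0 // ltW.
have bZ : b * (H / N) `^ p <= (1 + Z) `^ p.
  have m0 : 0 <= mu `^ (- (alpha / 4)) := powR_ge0 _ _.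
  have -> : b = (mu `^ (- (alpha / 4))) `^ p.
    rewrite -powRrM (_ : - (alpha / 4) * p = - 2^-1); last first.
      by rewrite /p; field; rewrite gt_eqF.
    by rewrite powRN powR12_sqrt // ltW.
  rewrite -powRM //; apply: ge0_ler_powR; rewrite ?nnegrE ?(ltW p0) ?(ltW Z10) //.
    exact: mulr_ge0.
  apply: (@le_trans _ _ Z); last by rewrite lerDr.
  rewrite /Z -mulrA ler_wpM2r //.
  apply: (@le_trans _ _ (mu `^ (- alpha))).
    have hx : - alpha <= - (alpha / 4) by have := alpha0; lra.
    by apply: ger_powR => //; rewrite mu0.
  rewrite ler_peMl ?powR_ge0 //.
  have : 1 `^ alpha <= 8 `^ alpha :> R.
    by apply: ge0_ler_powR; rewrite ?nnegrE ?(ltW alpha0) // ler1n.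
  by rewrite powR1.
have ba2 : 1 + b / a <= 2 * (1 + Z) `^ p.
  have : b / a <= (1 + Z) `^ p.
    by apply: le_trans ba _; rewrite pE ge_max P1 bZ.
  lra.
have ba0 : 0 < b / a by exact: divr_gt0.
have P0 : 0 < (1 + Z) `^ p by exact: powR_gt0.
rewrite -ln_powR -lnM ?posrE // ler_ln ?posrE //; first exact: addr_gt0.
exact: mulr_gt0.
Qed.

(** The radius is taken with [e = N / H], so that the Holder error is at most
    [N], like the truncation error. *)
Lemma sqr_pointwise_le t y : 0 < t ->
  u y ^+ 2 <= N ^+ 2 * ((1 + t) / (8 * pi ^+ 2 * alpha) * ln (1 + Z)
    + ((1 + t) * ln 2 / (16 * pi ^+ 2) + (1 + t^-1) * (2 * K) ^+ 2)).
Proof.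
move=> t0.
have e0 : 0 < N / H by exact: divr_gt0.
have [a [a0 ab ae ba]] := exists_radius b0 e0 (divr_gt0 alpha0 (ltr0n _ 2)).
rewrite invf_div in ba.
have logs := log_le ba a0.
set l := ln (1 + b / a) in logs.
have l0 : 0 <= l by rewrite ln_ge0 // lerDl divr_ge0 // ltW.
have Ha : H * a `^ (alpha / 2) <= N by rewrite mulrC -ler_pdivlMr.
have h : `|u y| <= N * (Num.sqrt l / (4 * pi) + 2 * K).
  apply: le_trans (bound y a0 ab) _.
  rewrite -/l [leRHS]mulrDr; apply: lerD.
    by rewrite -mulrA [_^-1 * _]mulrC.
  rewrite (_ : N * (2 * K) = K * (N + N)); last by ring.
  by rewrite ler_wpM2l ?(ltW K_gt0) // lerD2l.
have h2 : u y ^+ 2 <= (N * (Num.sqrt l / (4 * pi) + 2 * K)) ^+ 2.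
  by rewrite -real_normK ?num_real // lerXn2r ?nnegrE // (le_trans _ h).
apply: le_trans h2 _; rewrite exprMn ler_wpM2l ?sqr_ge0 //.
apply: le_trans (sqrD_le_weighted _ _ t0) _.
rewrite addrA lerD2r exprMn sqr_sqrtr //.
have final (p : R) : 0 < p -> (1 + t) * (l * (4 * p)^-1 ^+ 2) <=
    (1 + t) / (8 * p ^+ 2 * alpha) * ln (1 + Z)
    + (1 + t) * ln 2 / (16 * p ^+ 2).
  move=> p0.
  have -> : (1 + t) / (8 * p ^+ 2 * alpha) * ln (1 + Z)
      + (1 + t) * ln 2 / (16 * p ^+ 2) =
      (1 + t) * ((ln 2 + 2 / alpha * ln (1 + Z)) * (4 * p)^-1 ^+ 2).
    by field; rewrite !gt_eqF.
  apply: ler_wpM2l; first by rewrite addr_ge0 // ltW.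
  by apply: ler_wpM2r => //; exact: sqr_ge0.
exact: final (pi_gt0 R).
Qed.

Lemma Linfty_sqr_le t : 0 < t ->
  fine (LpNorm +oo u) ^+ 2 <=
  N ^+ 2 * ((1 + t) / (8 * pi ^+ 2 * alpha) * ln (1 + Z)
    + ((1 + t) * ln 2 / (16 * pi ^+ 2) + (1 + t^-1) * (2 * K) ^+ 2)).
Proof.
move=> t0; set B := N ^+ 2 * _.
have uB y : u y ^+ 2 <= B by exact: sqr_pointwise_le.
have B0 : 0 <= B by apply: le_trans (uB 0); exact: sqr_ge0.
have le : (LpNorm +oo u <= (Num.sqrt B)%:E)%E.
  by apply: Linfty_le => y; rewrite -sqrtr_sqr ler_wsqrtr.
rewrite -(sqr_sqrtr B0) lerXn2r ?nnegrE ?sqrtr_ge0 //.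
  by rewrite fine_ge0 // Lnorm_ge0.
rewrite -lee_fin fineK //; exact: holder_Linfty_fin hol.
Qed.

End Conclusion.

Unset Implicit Arguments.

Theorem corollary1p5 (R : realType) (alpha : R) (halpha : 0 < alpha < 1)
    (lambda : R) (hlambda : (8 * pi ^+ 2 * alpha)^-1 < lambda) :
  exists2 C : R, 0 < C &
    forall mu : R, 0 < mu <= 1 ->
    forall u : R4 R -> R, H2rad u -> holder alpha u -> u <> (fun=> 0) ->
      fine (LpNorm +oo u) ^+ 2 <=
        lambda * munorm mu u ^+ 2 *
        ln (C + 8 `^ alpha * mu `^ (- alpha) * fine (holder_norm alpha u)
                / munorm mu u).
Proof.
have /andP[alpha0 alpha1] := halpha.
set l0 := (8 * pi ^+ 2 * alpha)^-1 in hlambda.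
have l00 : 0 < l0.
  by rewrite invr_gt0 mulr_gt0 // mulr_gt0 // exprn_gt0 // pi_gt0.
(* With this [t], [(1 + t) * l0] is the midpoint of [l0] and [lambda]. *)
pose t := (lambda / l0 - 1) / 2.
have t0 : 0 < t by rewrite divr_gt0 // subr_gt0 ltr_pdivlMr // mul1r.
pose l1 := (1 + t) * l0.
have l10 : 0 < l1 by rewrite mulr_gt0 // addr_gt0.
have l1l : l1 < lambda.
  have -> : l1 = (lambda + l0) / 2 by rewrite /l1 /t; field; rewrite gt_eqF.
  lra.
(* The part of [Linfty_sqr_le] that does not grow with the logarithm. *)
pose c : R := (1 + t) * ln 2 / (16 * pi ^+ 2)
  + (1 + t^-1) * (2 * (cutoff_cst + 10)) ^+ 2.
have c0 : 0 <= c.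
  have q0 : 0 < 16 * pi ^+ 2 :> R by rewrite mulr_gt0 // exprn_gt0 // pi_gt0.
  have w0 : 0 <= 1 + t by rewrite addr_ge0 // ltW.
  have v0 : 0 <= 1 + t^-1 by rewrite addr_ge0 // invr_ge0 ltW.
  have n0 : 0 <= ln 2 :> R by rewrite ln_ge0 // ler1n.
  apply: addr_ge0; last by apply: mulr_ge0 => //; exact: sqr_ge0.
  by apply: divr_ge0 (ltW q0); exact: mulr_ge0.
exists (expR (c / (lambda - l1))) => [|mu /andP[mu0 mu1] u [hu _] hol u0].
  exact: expR_gt0.
apply: le_trans (Linfty_sqr_le alpha0 alpha1 mu0 mu1 hu hol u0 t0) _.
rewrite [lambda * _]mulrC -[leRHS]mulrA; apply: ler_wpM2l; first exact: sqr_ge0.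
apply: log_absorb => //.
rewrite divr_ge0 ?sqrtr_ge0 // mulr_ge0 ?mulr_ge0 ?powR_ge0 //.
rewrite fine_ge0 // adde_ge0 ?Lnorm_ge0 ?holder_seminorm_ge0 //.
Qed.
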